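(* Let $\sigma\in\operatorname{int}(\pi_{\mathcal{T}}(\mathbb{B}_{\mathrm{op}}(n)))\subseteq\mathbb{R}^{\binom n2}$ and let $V_\sigma=\{X\in\mathrm{O}(n):\pi_{\mathcal{T}}(X)=\sigma\}$. The following assertions hold: 1. $|V_\sigma|=2^n$. 2. For each $i\in[n]$, there exist functions $\alpha_i(\sigma)<\beta_i(\sigma)$ (of $\sigma\in\operatorname{int}(\pi_{\mathcal{T}}(\mathbb{B}_{\mathrm{op}}(n)))$) such that $X_{i,i}\in\{\alpha_i(\sigma),\beta_i(\sigma)\}$ for each $X\in V_\sigma$. Below write $\alpha_i,\beta_i$ for $\alpha_i(\sigma),\beta_i(\sigma)$. 3. No two elements of $V_\sigma$ have the same diagonal entries. That is, for each $d\in\{\alpha_1,\beta_1\}\times\{\alpha_2,\beta_2\}\times\dots\times\{\alpha_n,\beta_n\}$, there is a unique $X\in V_\sigma$ such that $\operatorname{diag}(X)=d$. 4. For each $i\in[n]$, $\alpha_i$ and $\beta_i$ are continuous functions of $\sigma$. The function $\beta_i$ is concave in $\sigma$, and the function $\alpha_i$ is convex in $\sigma$. 5. $X\in V_\sigma$ is in $\mathrm{SO}(n)$ if and only if the number of $i$ such that $X_{i,i}=\alpha_i$ is even. 6. Given $\rho\in\{-1,1\}^n$, one can construct, in time $O(n^3)$, a matrix $X\in V_\sigma$ such that for every $i\in[n]$, $X_{i,i}=\alpha_i$ if $\rho_i=-1$ and $X_{i,i}=\beta_i$ if $\rho_i=1$.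
   Context: $\mathrm{O}(n)=\{X\in\mathbb{R}^{n\times n}:X^\intercal X=I\}$; $\mathrm{SO}(n)=\{X\in\mathrm{O}(n):\det(X)=1\}$; $\mathbb{B}_{\mathrm{op}}(n)=\{X\in\mathbb{R}^{n\times n}:\|X\|_{\mathrm{op}}\le1\}$ is the operator norm (maximum singular value) ball; $[n]=\{1,\dots,n\}$. The map $\pi_{\mathcal{T}}:\mathbb{R}^{n\times n}\to\mathbb{R}^{\binom n2}$, $\pi_{\mathcal{T}}(X)=(X_{ij})_{i<j}$, is the projection onto the strictly upper triangular entries; $\operatorname{diag}(X)$ is the vector of diagonal entries of $X$. Running time counts basic arithmetic operations on real numbers, including square roots, which are assumed to be performed exactly. *)

(* Defs.v *)
(* MathComp / MathComp-Analysis. *)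
From HB Require Import structures.
From mathcomp Require Import all_boot all_order all_algebra.
From mathcomp Require Import all_classical all_reals all_analysis.

Set Implicit Arguments.
Unset Strict Implicit.
Unset Printing Implicit Defensive.

Import Order.TTheory GRing.Theory Num.Theory.
Import numFieldNormedType.Exports.

Local Open Scope classical_set_scope.
Local Open Scope ring_scope.

Section Matrices.
Variables (R : realType) (n : nat).
Implicit Types (X : 'M[R]_n).

Definition orthogonal_group : set 'M[R]_n := [set X | X^T *m X = 1%:M].

Definition special_orthogonal_group : set 'M[R]_n :=
  [set X | orthogonal_group X /\ \det X = 1].

(* The library norm on matrices is the maximum of the absolute values of the
   entries, so the Euclidean norm has to be introduced separately. *)
Definition euclidean_norm (v : 'cV[R]_n) : R := Num.sqrt (\sum_i v i 0 ^+ 2).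

Definition operator_norm X : R :=
  sup [set euclidean_norm (X *m v) | v in [set v | euclidean_norm v <= 1]].

Definition operator_ball : set 'M[R]_n := [set X | operator_norm X <= 1].

End Matrices.

Definition strict_upper (n : nat) : finType :=
  {ij : 'I_n * 'I_n | (ij.1 < ij.2)%N}.

(* R^(n choose 2) is rendered as 'rV[R]_#|strict_upper n|: row vectors whose
   coordinates are numbered by the enumeration of the positions (i, j), i < j. *)
Lemma card_strict_upper (n : nat) : #|strict_upper n| = 'C(n, 2).
Proof.
rewrite card_sig -sum1_card.
rewrite (eq_bigl (fun ij : 'I_n * 'I_n => true && (ij.1 < ij.2)%N)) //.
rewrite -(pair_big_dep xpredT (fun i j : 'I_n => (i < j)%N) (fun _ _ => 1%N)) /=.
rewrite (exchange_big_dep xpredT) //= -bin2_sum big_mkord.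
by apply: eq_bigr => j _; rewrite (big_ord_narrow (ltnW (ltn_ord j))) sum1_card card_ord.
Qed.

Section Projection.
Variables (R : realType) (n : nat).

Definition upper_proj (X : 'M[R]_n) : 'rV[R]_#|strict_upper n| :=
  \row_k X (val (enum_val k)).1 (val (enum_val k)).2.

Definition diag_vec (X : 'M[R]_n) : 'rV[R]_n := \row_i X i i.

Definition Vset (s : 'rV[R]_#|strict_upper n|) : set 'M[R]_n :=
  [set X | orthogonal_group X /\ upper_proj X = s].

Definition int_proj_ball : set 'rV[R]_#|strict_upper n| :=
  interior (upper_proj @` @operator_ball R n).

Definition upper_matrix (s : 'rV[R]_#|strict_upper n|) : 'M[R]_n :=
  \matrix_(i, j) if insub (i, j) is Some k then s 0 (enum_rank k) else 0.

Lemma upper_matrixK : cancel upper_matrix upper_proj.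
Proof.
move=> s; apply/rowP => k; rewrite !mxE -surjective_pairing valK.
by rewrite enum_valK.
Qed.

End Projection.

Definition concave_function (R : realType) (E : lmodType R)
    (D : set (convex_lmodType E)) (f : convex_lmodType E -> R^o) : Prop :=
  convex_function D (fun x => - f x).

(* Running time is measured on a real random-access machine.  A program is a
   finite piece of first-order syntax that mentions neither the dimension nor
   any particular real number.  The machine has natural-number registers and
   two-dimensional arrays of exact reals addressed by natural numbers; nothing
   converts a real into a natural number, so data can influence the control
   flow only through comparisons.  Bounded iteration is the only form of loop,
   hence every program terminates.

   Every node of a program that is evaluated costs one unit, including address
   computation, tests and loop control, so the cost bounds the number of
   arithmetic operations on reals from above.  Division by zero and square
   roots of negative numbers return 0, as in the library; a guard of constant
   cost produces the same value on a machine where these are undefined. *)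

Inductive iexp : Type :=
  | IConst of nat
  | IReg of nat
  | IAdd of iexp & iexp
  | ISub of iexp & iexp.

(* [RGet a i j] reads entry (i, j) of array number [a]. *)
Inductive rexp : Type :=
  | RConst of nat
  | RGet of nat & iexp & iexp
  | RAdd of rexp & rexp
  | RSub of rexp & rexp
  | RMul of rexp & rexp
  | RDiv of rexp & rexp
  | RSqrt of rexp.

Inductive bexp : Type :=
  | BILe of iexp & iexp
  | BRLe of rexp & rexp.

(* [RSet a i j e] stores [e] in entry (i, j) of array [a];
   [For x e c] runs [c] with register [x] set to 0, 1, ..., v - 1 in turn, where
   v is the value of [e] on entry. *)
Inductive cmd : Type :=
  | Skip
  | ISet of nat & iexp
  | RSet of nat & iexp & iexp & rexp
  | Seq of cmd & cmd
  | If of bexp & cmd & cmd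
  | For of nat & iexp & cmd.

Fixpoint icost (e : iexp) : nat :=
  match e with
  | IConst _ | IReg _ => 1
  | IAdd e1 e2 | ISub e1 e2 => (icost e1 + icost e2).+1
  end.

Fixpoint rcost (e : rexp) : nat :=
  match e with
  | RConst _ => 1
  | RGet _ i j => (icost i + icost j).+1
  | RAdd e1 e2 | RSub e1 e2 | RMul e1 e2 | RDiv e1 e2 =>
      (rcost e1 + rcost e2).+1
  | RSqrt e1 => (rcost e1).+1
  end.

Definition bcost (b : bexp) : nat :=
  match b with
  | BILe e1 e2 => (icost e1 + icost e2).+1
  | BRLe e1 e2 => (rcost e1 + rcost e2).+1
  end.

Section Semantics.
Variable R : realType.

Record state : Type := State {
  regs : nat -> nat;
  arrays : nat -> nat -> nat -> R
}.

Definition set_reg (s : state) (x v : nat) : state :=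
  State (fun y => if y == x then v else regs s y) (arrays s).

Definition set_entry (s : state) (a i j : nat) (v : R) : state :=
  State (regs s) (fun a' i' j' =>
    if [&& a' == a, i' == i & j' == j] then v else arrays s a' i' j').

Fixpoint ieval (s : state) (e : iexp) : nat :=
  match e with
  | IConst k => k
  | IReg x => regs s x
  | IAdd e1 e2 => (ieval s e1 + ieval s e2)%N
  | ISub e1 e2 => (ieval s e1 - ieval s e2)%N
  end.

Fixpoint reval (s : state) (e : rexp) : R :=
  match e with
  | RConst k => k%:R
  | RGet a i j => arrays s a (ieval s i) (ieval s j)
  | RAdd e1 e2 => reval s e1 + reval s e2
  | RSub e1 e2 => reval s e1 - reval s e2
  | RMul e1 e2 => reval s e1 * reval s e2
  | RDiv e1 e2 => reval s e1 / reval s e2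
  | RSqrt e1 => Num.sqrt (reval s e1)
  end.

Definition beval (s : state) (b : bexp) : bool :=
  match b with
  | BILe e1 e2 => (ieval s e1 <= ieval s e2)%N
  | BRLe e1 e2 => reval s e1 <= reval s e2
  end.

(* Final state and running time. *)
Fixpoint exec (c : cmd) (s : state) : state * nat :=
  match c with
  | Skip => (s, 1%N)
  | ISet x e => (set_reg s x (ieval s e), (icost e).+1)
  | RSet a i j e =>
      (set_entry s a (ieval s i) (ieval s j) (reval s e),
       (icost i + icost j + rcost e).+1)
  | Seq c1 c2 =>
      let r1 := exec c1 s in
      let r2 := exec c2 r1.1 in
      (r2.1, (r1.2 + r2.2).+1)
  | If b c1 c2 =>
      let r := exec (if beval s b then c1 else c2) s in
      (r.1, (bcost b + r.2).+1)
  | For x e c1 =>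
      iteri (ieval s e)
        (fun k acc =>
           let r := exec c1 (set_reg acc.1 x k) in
           (r.1, (acc.2 + r.2).+1))
        (s, (icost e).+1)
  end.

Definition load (m n : nat) (A : 'M[R]_(m, n)) (i j : nat) : R :=
  match insub i, insub j with
  | Some i', Some j' => A i' j'
  | _, _ => 0
  end.

(* Register 0 holds n, array 0 holds the strictly upper triangular data, row 0
   of array 1 holds the sign vector; everything else is 0.  Indices start at 0. *)
Definition input_state (n : nat) (s : 'rV[R]_#|strict_upper n|)
    (rho : 'rV[R]_n) : state :=
  State (fun x => if x == 0%N then n else 0%N)
    (fun a => match a with
              | 0%N => load (upper_matrix s)
              | 1%N => load rho
              | _ => fun _ _ => 0
              end).

(* The result is read off array 2. *)
Definition output_matrix (n : nat) (s : state) : 'M[R]_n :=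
  \matrix_(i, j) arrays s 2 i j.

End Semantics.

(* Main.v *)
(* The last column of X is peeled off.  Let c be its part above the diagonal;
   data in the interior come from a strict contraction, so |c| < 1 and
   1 - c c^T = L L^T for an explicit lower triangular L with positive diagonal.
   X is orthogonal iff its leading block is L Y with Y orthogonal, its corner x
   is one of the two square roots of 1 - |c|^2, and its last row is the one that
   x and Y dictate.  As L is lower triangular, the strict upper triangle of Y is
   obtained from that of X by forward substitution, whatever x is, and X_ii is an
   increasing affine function of Y_ii whose coefficients depend on the data only.
   By induction there is one free sign for each diagonal entry, and det X is the
   product of these signs.  The same reduction maps contractions to contractions,
   so alpha_i and beta_i are the extreme values of Z_ii over all contractions Z
   with the given data; this gives convexity and concavity.  Finally L and its
   inverse act on a vector in linear time, because the part of L below the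
   diagonal has rank one. *)
Require Import Defs.
From mathcomp Require Import all_boot all_order all_algebra.
From mathcomp Require Import all_classical all_reals all_analysis.
From mathcomp Require Import ring lra zify.

Set Implicit Arguments.
Unset Strict Implicit.
Unset Printing Implicit Defensive.

Import Order.TTheory GRing.Theory Num.Theory.
Import numFieldNormedType.Exports.

Local Open Scope classical_set_scope.
Local Open Scope ring_scope.

(** * Cholesky factor of a rank-one downdate *)

Section Downdate.
Variable R : rcfType.
Implicit Types c y v : nat -> R.

(** The determinant of the leading block of size i of 1 - c c^T; hence the Cholesky pivots are
    ratios of consecutive [resid_norm]s. *)
Definition residual c i : R := 1 - \sum_(l < i) c l ^+ 2.
Definition resid_norm c i : R := Num.sqrt (residual c i).
Definition pivot c i : R := resid_norm c i.+1 / resid_norm c i.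
Definition weight c i : R := c i / (resid_norm c i * resid_norm c i.+1).
Definition prefix_form c y i : R := \sum_(l < i) weight c l * y l.
(* The Cholesky factor of 1 - c c^T, applied to y. *)
Definition chol_mul c y i : R := pivot c i * y i - c i * prefix_form c y i.

(** Forward substitution that carries only the prefix form of the solution found so far, so each new
    unknown takes constant work. *)
Fixpoint solve_form c v i : R :=
  if i is i'.+1 then
    solve_form c v i'
    + weight c i' * ((v i' + c i' * solve_form c v i') / pivot c i')
  else 0.
Definition chol_solve c v i : R := (v i + c i * solve_form c v i) / pivot c i.

Lemma prefix_formS c y i :
  prefix_form c y i.+1 = prefix_form c y i + weight c i * y i.
Proof. by rewrite /prefix_form big_ord_recr. Qed.

Lemma prefix_form_solve c v i : prefix_form c (chol_solve c v) i = solve_form c v i.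
Proof.
by elim: i => [|i IH]; [rewrite /prefix_form big_ord0 | rewrite prefix_formS IH].
Qed.

Lemma residualS c i : residual c i.+1 = residual c i - c i ^+ 2.
Proof. by rewrite /residual big_ord_recr /= opprD addrA. Qed.

Lemma residual_decr c i j : (i <= j)%N -> residual c j <= residual c i.
Proof.
elim: j => [|j IH]; first by rewrite leqn0 => /eqP ->.
rewrite leq_eqVlt ltnS => /orP [/eqP -> //|/IH h].
by rewrite residualS; apply: le_trans h; rewrite gerBl sqr_ge0.
Qed.

(** * Dependence on initial segments only *)

Lemma eq_residual c c' i : (forall l, (l < i)%N -> c l = c' l) ->
  residual c i = residual c' i.
Proof. by move=> h; congr (1 - _); apply: eq_bigr => l _; rewrite h. Qed.

Lemma eq_resid_norm c c' i : (forall l, (l < i)%N -> c l = c' l) ->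
  resid_norm c i = resid_norm c' i.
Proof. by move=> h; rewrite /resid_norm (eq_residual h). Qed.

Lemma eq_pivot c c' i : (forall l, (l <= i)%N -> c l = c' l) ->
  pivot c i = pivot c' i.
Proof.
move=> h; rewrite /pivot (eq_resid_norm (c' := c')) // (eq_resid_norm (c' := c')) //.
by move=> l /ltnW /h.
Qed.

Lemma eq_weight c c' i : (forall l, (l <= i)%N -> c l = c' l) ->
  weight c i = weight c' i.
Proof.
move=> h; rewrite /weight (eq_resid_norm (c' := c')) ?(eq_resid_norm (i := i.+1) (c' := c')) ?h //.
by move=> l /ltnW /h.
Qed.

Lemma eq_prefix_form c c' y y' i : (forall l, (l < i)%N -> c l = c' l) ->
  (forall l, (l < i)%N -> y l = y' l) -> prefix_form c y i = prefix_form c' y' i.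
Proof.
move=> hc hy; apply: eq_bigr => l _; rewrite hy // (eq_weight (c' := c')) // => k kl.
by apply: hc; apply: leq_ltn_trans kl _.
Qed.

(** Triangularity of the factor. Later it ensures that entries above the diagonal are never
    influenced by entries on or below it. *)
Lemma eq_chol_mul c c' y y' i : (forall l, (l <= i)%N -> c l = c' l) ->
  (forall l, (l <= i)%N -> y l = y' l) -> chol_mul c y i = chol_mul c' y' i.
Proof.
move=> hc hy; rewrite /chol_mul hy // hc // (eq_pivot (c' := c')) //.
by rewrite (@eq_prefix_form c c' y y') // => l /ltnW; [apply: hc | apply: hy].
Qed.

Lemma eq_solve_form c c' v v' i : (forall l, (l < i)%N -> c l = c' l) ->
  (forall l, (l < i)%N -> v l = v' l) -> solve_form c v i = solve_form c' v' i.
Proof.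
elim: i => [//|i IH] hc hv /=.
have hci l : (l <= i)%N -> c l = c' l by rewrite -ltnS; exact: hc.
rewrite IH; try (by move=> l /ltnW; rewrite -ltnS; auto).
by rewrite (eq_weight (c' := c')) // (eq_pivot (c' := c')) // hc // hv.
Qed.

Lemma eq_chol_solve c c' v v' i : (forall l, (l <= i)%N -> c l = c' l) ->
  (forall l, (l <= i)%N -> v l = v' l) -> chol_solve c v i = chol_solve c' v' i.
Proof.
move=> hc hv; rewrite /chol_solve hv // hc // (eq_pivot (c' := c')) //.
by rewrite (@eq_solve_form c c' v v') // => l /ltnW; [apply: hc | apply: hv].
Qed.

Section Positive.
Variables (c : nat -> R) (m : nat).
Hypothesis q_gt0 : 0 < residual c m.

Lemma residual_gt0 i : (i <= m)%N -> 0 < residual c i.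
Proof. by move/(residual_decr c); apply: lt_le_trans. Qed.

Lemma resid_norm_gt0 i : (i <= m)%N -> 0 < resid_norm c i.
Proof. by move=> h; rewrite sqrtr_gt0 residual_gt0. Qed.

Lemma resid_norm_neq0 i : (i <= m)%N -> resid_norm c i != 0.
Proof. by move/resid_norm_gt0/lt0r_neq0. Qed.

Lemma sqr_resid_norm i : (i <= m)%N -> resid_norm c i ^+ 2 = residual c i.
Proof. by move=> h; rewrite sqr_sqrtr // ltW // residual_gt0. Qed.

Lemma pivot_gt0 i : (i < m)%N -> 0 < pivot c i.
Proof. by move=> h; rewrite divr_gt0 // resid_norm_gt0 // ltnW. Qed.

Lemma chol_solveK v i : (i < m)%N -> chol_mul c (chol_solve c v) i = v i.
Proof.
move=> im; rewrite /chol_mul prefix_form_solve /chol_solve.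
by have := lt0r_neq0 (pivot_gt0 im) => h; field.
Qed.

Let resid_normS i : (i < m)%N ->
  c i ^+ 2 = resid_norm c i ^+ 2 - resid_norm c i.+1 ^+ 2.
Proof.
by move=> im; rewrite !sqr_resid_norm ?(ltnW im) // residualS; ring.
Qed.

(** In matrix form c^T L = q t^T, with t the vector [weight c] and q the residual. The induction
    rests on c_i^2 being the difference of two consecutive residuals. *)
Lemma dot_chol_mul y i : (i <= m)%N ->
  \sum_(l < i) c l * chol_mul c y l = residual c i * prefix_form c y i.
Proof.
elim: i => [|i IH] im; first by rewrite /prefix_form !big_ord0 mulr0.
rewrite big_ord_recr /= IH ?(ltnW im) // prefix_formS.
rewrite -!sqr_resid_norm ?(ltnW im) //.
have := resid_norm_neq0 im; have := resid_norm_neq0 (ltnW im).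
have := resid_normS im; rewrite /chol_mul /pivot /weight.
move: (resid_norm c i) (resid_norm c i.+1) => a b h a0 b0.
(* [field] does not know the relation between a, b and c_i. Once it is used for the coefficient of
   the prefix form, the rest is an identity in free variables. *)
rewrite [RHS](_ : _ = (a ^+ 2 - c i ^+ 2) * prefix_form c y i
  + b ^+ 2 * (c i / (a * b) * y i)); last by rewrite h; ring.
by field; rewrite a0 b0.
Qed.

(* L^T L = 1 - q t t^T, where L is the factor of [chol_mul], t the vector
   [weight c] and q the residual; equivalently L L^T = 1 - c c^T. *)
Lemma gram_chol_mul y y' i : (i <= m)%N ->
  \sum_(l < i) chol_mul c y l * chol_mul c y' l =
  \sum_(l < i) y l * y' l - residual c i * (prefix_form c y i * prefix_form c y' i).
Proof.
elim: i => [|i IH] im; first by rewrite /prefix_form !big_ord0; ring.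
rewrite !big_ord_recr /= IH ?(ltnW im) // !prefix_formS.
rewrite -!sqr_resid_norm ?(ltnW im) //.
have := resid_norm_neq0 im; have := resid_norm_neq0 (ltnW im).
have := resid_normS im; rewrite /chol_mul /pivot /weight.
move: (\sum_(l < i) y l * y' l) (prefix_form c y i) (prefix_form c y' i) => S T T'.
move: (resid_norm c i) (resid_norm c i.+1) => a b h a0 b0.
apply/eqP; rewrite -subr_eq0; apply/eqP.
(* The two sides differ by a multiple of the relation c_i^2 = a^2 - b^2. *)
rewrite (_ : _ - _ = (c i ^+ 2 - (a ^+ 2 - b ^+ 2)) *
   (T * T' + y i * y' i / a ^+ 2)); last by field; rewrite a0 b0.
by rewrite h subrr mul0r.
Qed.

End Positive.

End Downdate.

(** * Orthogonal completions *)

Section Completion.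
Variable R : rcfType.
Implicit Types (A X Z : nat -> nat -> R) (rho c v : nat -> R).

(** Matrices are functions on pairs of naturals, so passing to the leading block changes only a
    bound and needs no cast. *)
Definition column A j : nat -> R := fun i => A i j.

(** Column m stays in place, because [backward] must read c from it again. *)
Definition forward m A : nat -> nat -> R := fun i j =>
  if (i < j < m)%N then chol_solve (column A m) (column A j) i else A i j.

Definition backward rho m A : nat -> nat -> R := fun i j =>
  let c := column A m in let x := rho m * resid_norm c m in
  if (i < m)%N && (j < m)%N then chol_mul c (column A j) i
  else if (i == m) && (j < m)%N then - x * prefix_form c (column A j) m
  else if (i == m) && (j == m) then x else A i j.

Fixpoint completion rho n A : nat -> nat -> R :=
  if n is m.+1 then backward rho m (completion rho m (forward m A)) else A.

Definition contractive n Z := forall v,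
  \sum_(i < n) (\sum_(j < n) Z i j * v j) ^+ 2 <= \sum_(j < n) v j ^+ 2.

Definition strict_contractive n Z := forall v, (exists2 j, (j < n)%N & v j != 0) ->
  \sum_(i < n) (\sum_(j < n) Z i j * v j) ^+ 2 < \sum_(j < n) v j ^+ 2.

Definition orthonormal_columns n X := forall j k, (j < n)%N -> (k < n)%N ->
  \sum_(i < n) X i j * X i k = (j == k)%:R.

Definition agree n X A := forall i j, (i < j)%N -> (j < n)%N -> X i j = A i j.

(** The form in which membership in the interior is carried through the induction: it passes from
    the data to the reduced data. *)
Definition contractible n A := exists2 Z, agree n Z A & strict_contractive n Z.

(** The counterpart of [forward] for a full matrix: the inverse of L acts on whole columns, also on
    and below the diagonal. *)
Definition reduce m Z : nat -> nat -> R :=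
  fun i j => chol_solve (column Z m) (column Z j) i.

Lemma eq_completion rho rho' n A : (forall i, (i < n)%N -> rho i = rho' i) ->
  completion rho n A = completion rho' n A.
Proof.
elim: n A => [//|m IH] A h /=; rewrite (IH (forward m A)); last first.
  by move=> i im; rewrite h // ltnW.
by apply/funext => i; apply/funext => j; rewrite /backward h.
Qed.

Lemma completion_out rho n A i j : (n <= i)%N || (n <= j)%N ->
  completion rho n A i j = A i j.
Proof.
elim: n A => [//|m IH] A h /=.
have hm : (m <= i)%N || (m <= j)%N by case/orP: h => /ltnW ->; rewrite ?orbT.
rewrite /backward; have -> : (i < m)%N && (j < m)%N = false by lia.
have -> : (i == m) && (j < m)%N = false by lia.
have -> : (i == m) && (j == m) = false by lia.
by rewrite IH // /forward; have -> : (i < j < m)%N = false by lia.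
Qed.

(** The recursive call writes only inside the leading block of size m, so both passes of a step use
    the same c. *)
Lemma column_completion rho m A :
  column (completion rho m (forward m A)) m = column A m.
Proof.
by apply/funext => i; rewrite /column completion_out ?leqnn ?orbT // /forward ltnn andbF.
Qed.

Section Step.
Variables (rho : nat -> R) (m : nat) (A : nat -> nat -> R).
Let C := completion rho m (forward m A).
Let c := column A m.

Lemma completion_block i j : (i < m)%N -> (j < m)%N ->
  completion rho m.+1 A i j = chol_mul c (column C j) i.
Proof. by move=> im jm; rewrite /= /backward im jm /= column_completion. Qed.

Lemma completion_row j : (j < m)%N -> completion rho m.+1 A m j =
  - (rho m * resid_norm c m) * prefix_form c (column C j) m.
Proof. by move=> jm; rewrite /= /backward ltnn eqxx jm /= column_completion. Qed.

Lemma completion_col i : (i < m)%N -> completion rho m.+1 A i m = c i.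
Proof.
move=> im; rewrite /= /backward ltnn andbF andbF ltn_eqF //=.
by rewrite -[LHS]/(column _ m i) column_completion.
Qed.

Lemma completion_corner : completion rho m.+1 A m m = rho m * resid_norm c m.
Proof. by rewrite /= /backward ltnn eqxx /= column_completion. Qed.

End Step.

Arguments completion : simpl never.

(** * Reduction of contractions *)

Lemma prefix_form_sum c Z v n i :
  prefix_form c (fun l => \sum_(j < n) Z l j * v j) i =
  \sum_(j < n) prefix_form c (column Z j) i * v j.
Proof.
rewrite /prefix_form (eq_bigr (fun j : 'I_n => \sum_(l < i) weight c l * Z l j * v j)).
  rewrite exchange_big; apply: eq_bigr => l _; rewrite mulr_sumr.
  by apply: eq_bigr => j _; rewrite mulrA.
by move=> j _; rewrite mulr_suml.
Qed.

Lemma chol_mul_sum c Z v n i :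
  chol_mul c (fun l => \sum_(j < n) Z l j * v j) i =
  \sum_(j < n) chol_mul c (column Z j) i * v j.
Proof.
rewrite /chol_mul prefix_form_sum !mulr_sumr -sumrB.
by apply: eq_bigr => j _; rewrite /column; ring.
Qed.

Lemma agree_residual m Z A i : (i <= m)%N -> agree m.+1 Z A ->
  residual (column Z m) i = residual (column A m) i.
Proof.
by move=> im h; apply: eq_residual => l li; rewrite /column h // (leq_trans li).
Qed.

(** For i < j, solving for entry (i, j) reads only rows up to i of columns j and m, all strictly
    above the diagonal. *)
Lemma agree_reduce m Z A : agree m.+1 Z A -> agree m (reduce m Z) (forward m A).
Proof.
move=> h i j ij jm; rewrite /reduce /forward ij jm /=.
apply: eq_chol_solve => l li; rewrite /column h //.
- exact: leq_ltn_trans li (ltn_trans ij jm).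
- exact: leq_ltn_trans li ij.
- exact: leqW.
Qed.

(* Testing Z on the vector (v, T), where T is the value at v of the linear form
   whose coefficients are the [prefix_form]s of the reduced columns, makes the
   cross terms cancel. *)
Lemma reduce_norm m Z v : 0 < residual (column Z m) m ->
  exists (w : nat -> R) (T : R), [/\ forall j, (j < m)%N -> w j = v j,
    \sum_(i < m.+1) (\sum_(j < m.+1) Z i j * w j) ^+ 2 =
      \sum_(i < m) (\sum_(j < m) reduce m Z i j * v j) ^+ 2 + T ^+ 2 +
      (\sum_(j < m.+1) Z m j * w j) ^+ 2 &
    \sum_(j < m.+1) w j ^+ 2 = \sum_(j < m) v j ^+ 2 + T ^+ 2].
Proof.
move=> q0; set c := column Z m; set Y := reduce m Z.
pose T := \sum_(j < m) prefix_form c (column Y j) m * v j.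
pose w j := if (j < m)%N then v j else T.
exists w, T; split; first by move=> j jm; rewrite /w jm.
  2: {
  rewrite big_ord_recr /= {2}/w ltnn; congr (_ + _).
  by apply: eq_bigr => j _; rewrite /w ltn_ord. }
rewrite big_ord_recr /=; congr (_ + _).
pose y i := \sum_(j < m) Y i j * v j.
have E (i : 'I_m) : \sum_(j < m.+1) Z i j * w j = chol_mul c y i + c i * T.
  rewrite big_ord_recr /= {2}/w ltnn; congr (_ + _).
  rewrite chol_mul_sum; apply: eq_bigr => j _; rewrite /w ltn_ord; congr (_ * _).
  exact/esym/(chol_solveK q0).
have Ty : prefix_form c y m = T by rewrite prefix_form_sum.
under eq_bigr do rewrite E.
rewrite (eq_bigr (fun i : 'I_m => chol_mul c y i * chol_mul c y i +
   (T *+ 2) * (c i * chol_mul c y i) + T ^+ 2 * c i ^+ 2)); last by move=> i _; ring.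
(* With q the residual, the sum becomes |y|^2 - q T^2 + 2 q T^2 + (1 - q) T^2, in which q
   cancels. *)
rewrite !big_split /= -!mulr_sumr (gram_chol_mul q0) // (dot_chol_mul q0) // Ty.
have -> : \sum_(i < m) c i ^+ 2 = 1 - residual c m by rewrite /residual; ring.
rewrite (eq_bigr (fun i : 'I_m => y i ^+ 2)) => [|i _]; last by rewrite expr2.
by rewrite /y; ring.
Qed.

Lemma reduce_contractive m Z : 0 < residual (column Z m) m ->
  contractive m.+1 Z -> contractive m (reduce m Z).
Proof.
move=> q0 h v; have [w [T [_ E1 E2]]] := reduce_norm v q0.
have := h w; rewrite E1 E2; have := sqr_ge0 (\sum_(j < m.+1) Z m j * w j); lra.
Qed.

Lemma reduce_strict_contractive m Z : 0 < residual (column Z m) m ->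
  strict_contractive m.+1 Z -> strict_contractive m (reduce m Z).
Proof.
move=> q0 h v [k km vk]; have [w [T [wv E1 E2]]] := reduce_norm v q0.
have : exists2 j, (j < m.+1)%N & w j != 0 by exists k; [exact: ltnW | rewrite wv].
move/h; rewrite E1 E2; have := sqr_ge0 (\sum_(j < m.+1) Z m j * w j); lra.
Qed.

Lemma sum_delta n (f : nat -> R) k : (k < n)%N ->
  \sum_(j < n) f j * (nat_of_ord j == k)%:R = f k.
Proof.
move=> kn; rewrite (bigD1 (Ordinal kn)) //= eqxx mulr1 big1 ?addr0 // => j jk.
by rewrite (_ : (nat_of_ord j == k) = false) ?mulr0 //; apply/negbTE.
Qed.

(** Testing on the last basis vector shows that the last column has norm at most 1. *)
Lemma contractive_corner m Z : contractive m.+1 Z ->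
  Z m m ^+ 2 <= residual (column Z m) m.
Proof.
move=> /(_ (fun j => (j == m)%:R)).
under eq_bigr do rewrite sum_delta //.
under [X in _ <= X]eq_bigr do rewrite expr2.
rewrite (sum_delta (fun j => (j == m)%:R)) // eqxx big_ord_recr /= /residual /column /=; lra.
Qed.

Lemma strict_contractive_residual m Z : strict_contractive m.+1 Z ->
  0 < residual (column Z m) m.
Proof.
move=> /(_ (fun j => (j == m)%:R)).
under eq_bigr do rewrite sum_delta //.
under [X in _ < X]eq_bigr do rewrite expr2.
rewrite (sum_delta (fun j => (j == m)%:R)) // eqxx big_ord_recr /= /residual /column /=.
have h : exists2 j, (j < m.+1)%N & ((j == m)%:R : R) != 0.
  by exists m; rewrite ?eqxx ?oner_eq0.
move/(_ h); have := sqr_ge0 (Z m m); lra.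
Qed.

Lemma contractible_residual m A : contractible m.+1 A ->
  0 < residual (column A m) m.
Proof.
case=> Z ag /strict_contractive_residual; by rewrite (agree_residual _ ag).
Qed.

Lemma contractible_forward m A : contractible m.+1 A -> contractible m (forward m A).
Proof.
case=> Z ag h; exists (reduce m Z); first exact: agree_reduce.
exact: reduce_strict_contractive (strict_contractive_residual h) h.
Qed.

(** Above the diagonal, L is applied to entries of the recursive completion that are again
    prescribed, namely those produced by [forward]; so it undoes the substitution. *)
Lemma completion_agree rho n A : contractible n A -> agree n (completion rho n A) A.
Proof.
elim: n A => [//|m IH] A gA i j ij; rewrite ltnS leq_eqVlt => /orP [/eqP jm|jm].
  by rewrite jm completion_col // -jm.
have im := ltn_trans ij jm; rewrite completion_block //.
have {}IH := IH _ (contractible_forward gA).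
rewrite -[RHS](chol_solveK (contractible_residual gA) (column A j) im).
apply: eq_chol_mul => // l li; rewrite /column IH ?(leq_ltn_trans li) //.
by rewrite /forward (leq_ltn_trans li) // jm.
Qed.

(** Multiplication by L lowers the inner product of two columns by q times the product of their
    prefix forms. The last row restores exactly this amount, since the corner squares to q. *)
Lemma completion_orthonormal rho n A :
  (forall i, (i < n)%N -> rho i ^+ 2 = 1) -> contractible n A ->
  orthonormal_columns n (completion rho n A).
Proof.
elim: n A => [//|m IH] A hrho gA.
have q0 := contractible_residual gA.
have {}IH := IH _ (fun i im => hrho i (ltnW im)) (contractible_forward gA).
set c := column A m in q0; set C := completion rho m (forward m A) in IH.
have s2 : (rho m * resid_norm c m) ^+ 2 = residual c m.
  by rewrite exprMn hrho // mul1r (sqr_resid_norm q0).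
have cross j : (j < m)%N -> \sum_(i < m.+1)
    completion rho m.+1 A i j * completion rho m.+1 A i m = 0.
  move=> jm; rewrite big_ord_recr /= completion_row // completion_corner -/c -/C.
  rewrite (eq_bigr (fun i : 'I_m => c i * chol_mul c (column C j) i)); last first.
    by move=> i _; rewrite completion_block // completion_col // mulrC.
  by rewrite (dot_chol_mul q0) // -s2; ring.
move=> j k; rewrite !ltnS (leq_eqVlt j) (leq_eqVlt k).
case/orP => [/eqP ->|jm]; case/orP => [/eqP ->|km].
- rewrite eqxx big_ord_recr /= completion_corner -expr2 s2 /residual.
  under eq_bigr do rewrite completion_col // -expr2.
  by ring.
- rewrite gtn_eqF // -[RHS](cross k) //.
  by apply: eq_bigr => i _; rewrite mulrC.
- by rewrite ltn_eqF // cross.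
- rewrite big_ord_recr /= !completion_row // -/c -/C.
  under eq_bigr do rewrite !completion_block //.
  rewrite (gram_chol_mul q0) // -/C -s2 -(IH j k) //; ring.
Qed.

(** The unit last column gives x^2 = q > 0 for the corner x. As x is nonzero, orthogonality to the
    last column determines the last row, and then the Gram identity makes the reduced block
    orthogonal. The new sign is x divided by the square root of q. *)
Lemma completion_surj n A X : contractible n A -> orthonormal_columns n X -> agree n X A ->
  exists2 rho : nat -> R, (forall i, (i < n)%N -> rho i = 1 \/ rho i = -1) &
    forall i j, (i < n)%N -> (j < n)%N -> X i j = completion rho n A i j.
Proof.
elim: n A X => [|m IH] A X gA oX aX; first by exists (fun=> 1).
have q0 := contractible_residual gA; set c := column A m in q0.
have cX l : (l < m)%N -> X l m = c l by move=> lm; rewrite aX.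
have qX : residual (column X m) m = residual c m by rewrite (agree_residual _ aX).
pose Y := reduce m X; pose x := X m m.
have x2 : x ^+ 2 = residual c m.
  have := oX m m (ltnSn m) (ltnSn m); rewrite eqxx big_ord_recr /= -expr2 -/x -qX /residual => h.
  by under eq_bigr do rewrite expr2; rewrite -[1]h /column; ring.
have x0 : x != 0 by rewrite -sqrf_eq0 x2 lt0r_neq0.
have XE i j : (i < m)%N -> X i j = chol_mul c (column Y j) i.
  move=> im; rewrite -[LHS]/(column X j i) -(chol_solveK (m := m) (c := column X m)) ?qX //.
  by apply: eq_chol_mul => // l li; rewrite /column cX // (leq_ltn_trans li).
have uE j : (j < m)%N -> X m j = - x * prefix_form c (column Y j) m.
  move=> jm; have := oX m j (ltnSn m) (ltnW jm); rewrite gtn_eqF // big_ord_recr /= -/x.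
  rewrite (eq_bigr (fun i : 'I_m => c i * chol_mul c (column Y j) i)); last first.
    by move=> i _; rewrite cX // XE.
  rewrite (dot_chol_mul q0) // -x2 => /eqP.
  rewrite expr2 -mulrA -mulrDr mulf_eq0 (negbTE x0) /= addrC addr_eq0 => /eqP ->.
  by rewrite mulNr.
have oY : orthonormal_columns m Y.
  move=> j k jm km; have := oX j k (ltnW jm) (ltnW km).
  rewrite big_ord_recr /= !uE //.
  under eq_bigr do rewrite !XE //.
  rewrite (gram_chol_mul q0) // -x2 => <-.
  by rewrite /column; ring.
have [rho hrho E] := IH _ _ (contractible_forward gA) oY (agree_reduce aX).
have s0 := resid_norm_gt0 q0 (leqnn m).
pose rho' i := if (i < m)%N then rho i else x / resid_norm c m.
have r2 : (x / resid_norm c m) ^+ 2 = 1.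
  by rewrite exprMn exprVn (sqr_resid_norm q0) // x2 divff // lt0r_neq0.
have rE : rho' m * resid_norm c m = x by rewrite /rho' ltnn divfK // lt0r_neq0.
exists rho'.
  move=> i; rewrite ltnS leq_eqVlt => /orP [/eqP ->|im]; last first.
    by rewrite /rho' im; apply: hrho.
  by rewrite /rho' ltnn; move/eqP: r2; rewrite sqrf_eq1 => /orP [] /eqP; auto.
have eC : completion rho' m (forward m A) = completion rho m (forward m A).
  by apply: eq_completion => i im; rewrite /rho' im.
move=> i j; rewrite !ltnS (leq_eqVlt i) (leq_eqVlt j).
case/orP => [/eqP ->|im]; case/orP => [/eqP ->|jm].
- by rewrite completion_corner rE.
- rewrite completion_row // rE uE // eC; congr (_ * _).
  by apply: eq_prefix_form => // l lm; rewrite /column E.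
- by rewrite completion_col // cX.
- rewrite completion_block // XE // eC.
  by apply: eq_chol_mul => // l li; rewrite /column E // (leq_ltn_trans li).
Qed.

(** Each step multiplies the diagonal entry of the reduced matrix by a pivot and subtracts a term
    built from prescribed entries, the same for all signs. So g, a product of pivots and one
    [resid_norm], is chosen before the signs. *)
Lemma completion_diag n A i : contractible n A -> (i < n)%N ->
  exists2 g, 0 < g & forall rho rho',
    completion rho n A i i - completion rho' n A i i = g * (rho i - rho' i).
Proof.
elim: n A => [//|m IH] A gA; have q0 := contractible_residual gA.
rewrite ltnS leq_eqVlt => /orP [/eqP ->|im].
  exists (resid_norm (column A m) m) => [|rho rho']; first exact: resid_norm_gt0 q0 _ _.
  by rewrite !completion_corner; ring.
have [g g0 E] := IH _ (contractible_forward gA) im.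
exists (pivot (column A m) i * g) => [|rho rho'].
  by rewrite mulr_gt0 // (pivot_gt0 q0).
rewrite !completion_block // /chol_mul -[RHS]mulrA -E /column.
set F := completion rho m _; set F' := completion rho' m _.
rewrite (_ : prefix_form _ (fun l => F l i) i = prefix_form (fun l => A l m) (fun l => F' l i) i).
  by ring.
apply: eq_prefix_form => // l li.
by rewrite /F /F' !(completion_agree _ (contractible_forward gA)).
Qed.

(** At the corner this is the norm bound on the last column. Elsewhere [Z i i] and both completions
    arise from reduced diagonal entries by the same increasing affine map, and the reduced matrix is
    again a contraction. *)
Lemma completion_bounds n A Z i : contractible n A -> contractive n Z -> agree n Z A ->
  (i < n)%N ->
  completion (fun=> -1) n A i i <= Z i i <= completion (fun=> 1) n A i i.
Proof.
elim: n A Z => [//|m IH] A Z gA kZ aZ; have q0 := contractible_residual gA.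
have qZ : residual (column Z m) m = residual (column A m) m by rewrite (agree_residual _ aZ).
rewrite ltnS leq_eqVlt => /orP [/eqP ->|im].
  rewrite !completion_corner mul1r mulN1r -ler_norml.
  have /(ler_wsqrtr) := contractive_corner kZ.
  by rewrite sqrtr_sqr qZ.
have kY : contractive m (reduce m Z) by apply: reduce_contractive; rewrite ?qZ.
have /andP [lo hi] := IH _ _ (contractible_forward gA) kY (agree_reduce aZ) im.
have -> : Z i i = chol_mul (column A m) (column (reduce m Z) i) i.
  rewrite -[LHS]/(column Z i i) -(chol_solveK (m := m) (c := column Z m)) ?qZ //.
  by apply: eq_chol_mul => // l li; rewrite /column aZ // (leq_ltn_trans li).
rewrite !completion_block // /chol_mul.
have T rho : prefix_form (column A m) (column (completion rho m (forward m A)) i) i =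
    prefix_form (column A m) (column (reduce m Z) i) i.
  apply: eq_prefix_form => // l li; rewrite /column.
  by rewrite (completion_agree _ (contractible_forward gA)) // (agree_reduce aZ).
rewrite !T !lerD2r !(ler_pM2l (pivot_gt0 q0 im)).
by rewrite lo hi.
Qed.

End Completion.

(** * Determinant *)

Section Determinant.
Variable R : rcfType.
Implicit Types (X A : nat -> nat -> R) (rho c : nat -> R).

Definition mx_of n X : 'M[R]_n := \matrix_(i, j) X i j.

(* The last step of [completion] is the product
   [[1, 0], [0, x]] [[L, c], [- t, 1]] [[Y, 0], [0, 1]], where L is the factor of
   [chol_mul], t the row vector [weight c] and L + c t is upper triangular. *)
Lemma det_completionS rho m A : contractible m.+1 A ->
  \det (mx_of m.+1 (completion rho m.+1 A)) =
  rho m * \det (mx_of m (completion rho m (forward m A))).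
Proof.
move=> gA; have q0 := contractible_residual gA.
set c := column A m in q0; set C := completion rho m (forward m A).
pose x := rho m * resid_norm c m.
pose L : 'M[R]_m := \matrix_(i, j)
  (pivot c i * (i == j)%:R - c i * weight c j * (j < i)%N%:R).
pose t : 'rV[R]_m := \row_j weight c j.
pose d : 'cV[R]_m := \col_i c i.
have E : mx_of (m + 1) (completion rho m.+1 A) =
    block_mx 1%:M 0 0 x%:M *m block_mx L d (- t) 1 *m block_mx (mx_of m C) 0 0 1.
  have tC (j : 'I_m) : prefix_form c (column C j) m = (t *m mx_of m C) 0 j.
    by rewrite mxE; apply: eq_bigr => l _; rewrite !mxE.
  rewrite !mulmx_block !mul1mx !mul0mx !mulmx0 !mulmx1 !addr0 !add0r mul_scalar_mx.
  apply/matrixP => i j; rewrite !mxE.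
  case: (splitP i) => i' ->; rewrite !mxE; case: (splitP j) => j' ->;
    rewrite ?(ord1 i') ?(ord1 j') ?addn0.
  - rewrite completion_block // /chol_mul /column mxE.
    under eq_bigr do rewrite !mxE mulrBl.
    rewrite sumrB (bigD1 i') //= eqxx mulr1 big1 ?addr0; last first.
      by move=> l; rewrite eq_sym => /negbTE ->; rewrite mulr0 mul0r.
    congr (_ - _); rewrite /prefix_form mulr_sumr.
    rewrite (big_ord_widen m (fun l => c i' * (weight c l * C l j'))); last exact: ltnW.
    rewrite big_mkcond /=; apply: eq_bigr => l _.
    by case: ltnP => _; rewrite /= ?mulr1 ?mulr0 ?mul0r // mulrA.
  - by rewrite completion_col // mxE.
  - by rewrite completion_row // tC -/c -/x mulNr -scalemxAl mulNmx !mxE mulrN.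
  - by rewrite completion_corner mxE eqxx mulr1n.
(* Adding c t cancels L below the diagonal. With a and b the consecutive norms, the diagonal entry
   is b / a + c_i^2 / (a b) = a / b, and the product telescopes from the initial norm 1. *)
have upper_triangular_det : \det (L + d *m t) = (resid_norm c m)^-1.
  rewrite -det_tr det_trig; last first.
    apply/is_trig_mxP => i j ij; rewrite !mxE big_ord1 !mxE ij -val_eqE /= gtn_eqF //.
    by rewrite mulr0 mulr1; ring.
  have -> : \prod_i (L + d *m t)^T i i = \prod_(i < m) (resid_norm c i / resid_norm c i.+1).
    apply: eq_bigr => i _; rewrite !mxE big_ord1 !mxE ltnn eqxx mulr0 subr0 mulr1.
    have := resid_norm_neq0 q0 (ltnW (ltn_ord i)); have := resid_norm_neq0 q0 (ltn_ord i).
    have : c i ^+ 2 = resid_norm c i ^+ 2 - resid_norm c i.+1 ^+ 2.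
      by rewrite !(sqr_resid_norm q0) // ?residualS 1?ltnW //; ring.
    rewrite /pivot /weight; move: (resid_norm c i) (resid_norm c i.+1) => a b h b0 a0.
    rewrite [RHS](_ : _ = (b ^+ 2 + (a ^+ 2 - b ^+ 2)) / (a * b)); last by field; rewrite a0 b0.
    by rewrite -h; field; rewrite a0 b0.
  have s0 : resid_norm c 0 = 1 by rewrite /resid_norm /residual big_ord0 subr0 sqrtr1.
  elim: (m) q0 => [|k IH] q0; first by rewrite big_ord0 s0 invr1.
  have q0' := residual_gt0 q0 (leqnSn k).
  rewrite big_ord_recr /= IH //.
  have := resid_norm_neq0 q0 (leqnSn k); have := resid_norm_neq0 q0 (leqnn k.+1).
  by move=> h1 h2; field; rewrite h1 h2.
(* A unit lower triangular factor on the right clears - t and turns L into L + c t. *)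
have detM : \det (block_mx L d (- t) 1) = (resid_norm c m)^-1.
  rewrite -upper_triangular_det.
  have -> : \det (block_mx L d (- t) 1) =
      \det (block_mx L d (- t) 1 *m block_mx 1%:M 0 t 1).
    by rewrite det_mulmx (det_lblock 1%:M) !det1 !mulr1.
  rewrite mulmx_block !mulmx1 !mulmx0 !mul1mx !add0r addNr.
  by rewrite (det_ublock (L + d *m t)) det1 mulr1.
(* The block decomposition has size m + 1; generalizing the entries allows the change to [m.+1]. *)
transitivity (\det (mx_of (m + 1) (completion rho m.+1 A))).
  by move: (completion _ _ _) => X; rewrite addn1.
rewrite E !det_mulmx detM (det_lblock 1%:M) (det_lblock (mx_of m C)) !det1 det_scalar1.
by rewrite /x; have := resid_norm_neq0 q0 (leqnn m) => s0; field.
Qed.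

Lemma det_completion rho n A : contractible n A ->
  \det (mx_of n (completion rho n A)) = \prod_(i < n) rho i.
Proof.
elim: n A => [|m IH] A gA; first by rewrite det_mx00 big_ord0.
rewrite det_completionS // big_ord_recr [RHS]mulrC; congr (_ * _).
exact: IH (contractible_forward gA).
Qed.

End Determinant.

(** * Continuity *)

Section Continuity.
Variables (R : realType) (T : topologicalType) (t : T).
Implicit Types (f : T -> R) (c v : T -> nat -> R) (A : T -> nat -> nat -> R).

Local Notation C f := {for t, continuous (f : T -> R)}.

Lemma continuous_residual c i : (forall l, C (c ^~ l)) -> C (fun x => residual (c x) i).
Proof.
move=> hc; elim: i => [|i IH].
  rewrite (_ : (fun x => _) = cst 1); first exact: cst_continuous.
  by apply/funext => x; rewrite /residual big_ord0 subr0.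
rewrite (_ : (fun x => _) = (fun x => residual (c x) i - c x i * c x i)).
  by apply: continuousB => //; apply: continuousM.
by apply/funext => x; rewrite residualS expr2.
Qed.

Lemma continuous_resid_norm c i : (forall l, C (c ^~ l)) -> C (fun x => resid_norm (c x) i).
Proof.
move=> hc; apply: (@continuous_comp _ _ _ (fun x => residual (c x) i) Num.sqrt).
  exact: continuous_residual.
exact: sqrt_continuous.
Qed.

Lemma continuous_div f g : C f -> C g -> g t != 0 -> C (fun x => f x / g x).
Proof. by move=> cf cg g0; apply: continuousM => //; apply: continuousV. Qed.

Section Factor.
Variables (c : T -> nat -> R) (m : nat).
Hypotheses (q0 : 0 < residual (c t) m) (hc : forall l, C (c ^~ l)).

Lemma continuous_pivot i : (i < m)%N -> C (fun x => pivot (c x) i).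
Proof.
move=> im; apply: continuous_div; [exact: continuous_resid_norm | exact: continuous_resid_norm |].
by have := resid_norm_neq0 q0 (ltnW im).
Qed.

Lemma continuous_weight i : (i < m)%N -> C (fun x => weight (c x) i).
Proof.
move=> im; apply: continuous_div => //; last first.
  by rewrite mulf_neq0 // (resid_norm_neq0 q0) // ltnW.
by apply: continuousM; apply: continuous_resid_norm.
Qed.

Lemma continuous_solve_form v i : (i <= m)%N -> (forall l, C (v ^~ l)) ->
  C (fun x => solve_form (c x) (v x) i).
Proof.
move=> im hv; elim: i im => [|i IH] im; first exact: cst_continuous.
have {}IH := IH (ltnW im).
apply: continuousD => //; apply: continuousM; first exact: continuous_weight.
apply: continuous_div; last exact: lt0r_neq0 (pivot_gt0 q0 im).
- by apply: continuousD => //; apply: continuousM.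
- exact: continuous_pivot.
Qed.

Lemma continuous_chol_solve v i : (i < m)%N -> (forall l, C (v ^~ l)) ->
  C (fun x => chol_solve (c x) (v x) i).
Proof.
move=> im hv; apply: continuous_div; last exact: lt0r_neq0 (pivot_gt0 q0 im).
- apply: continuousD => //; apply: continuousM => //.
  by apply: continuous_solve_form => //; apply: ltnW.
- exact: continuous_pivot.
Qed.

Lemma continuous_prefix_form v i : (i <= m)%N -> (forall l, C (v ^~ l)) ->
  C (fun x => prefix_form (c x) (v x) i).
Proof.
move=> im hv; elim: i im => [|i IH] im.
  rewrite (_ : (fun x => _) = cst 0); first exact: cst_continuous.
  by apply/funext => x; rewrite /prefix_form big_ord0.
rewrite (_ : (fun x => _) = (fun x => prefix_form (c x) (v x) i + weight (c x) i * v x i)).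
  by apply: continuousD; [exact/IH/ltnW | apply: continuousM => //; apply: continuous_weight].
by apply/funext => x; rewrite prefix_formS.
Qed.

Lemma continuous_chol_mul v i : (i < m)%N -> (forall l, C (v ^~ l)) ->
  C (fun x => chol_mul (c x) (v x) i).
Proof.
move=> im hv; apply: continuousB; apply: continuousM => //.
- exact: continuous_pivot.
- by apply: continuous_prefix_form => //; apply: ltnW.
Qed.

End Factor.

(** Contractibility at t makes every residual positive there, so each division is by a quantity that
    is nonzero at t. It is inherited by the reduced data, which drives the induction. *)
Lemma continuous_completion rho n A : contractible n (A t) ->
  (forall i j, C (fun x => A x i j)) ->
  forall i j, C (fun x => completion rho n (A x) i j).
Proof.
elim: n A => [//|m IH] A gA hA i j.
have q0 := contractible_residual gA.
have hc k l : C (fun x => column (A x) k l) by exact: hA.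
have hF k l : C (fun x => forward m (A x) k l).
  rewrite /forward; case: andP => [[kl lm]|_] //.
  exact: continuous_chol_solve q0 _ _ _ (ltn_trans kl lm) _.
have {}IH k l : C (fun x => completion rho m (forward m (A x)) k l).
  exact: IH (contractible_forward gA) hF k l.
have hK k : C (fun x => column (completion rho m (forward m (A x))) j k) by exact: IH.
have hx : C (fun x => rho m * resid_norm (column (A x) m) m).
  by apply: continuousM; [exact: cst_continuous | exact: continuous_resid_norm].
rewrite (_ : (fun x => _) = fun x =>
    let c := column (A x) m in let F := completion rho m (forward m (A x)) in
    let d := rho m * resid_norm c m in
    if (i < m)%N && (j < m)%N then chol_mul c (column F j) i
    else if (i == m) && (j < m)%N then - d * prefix_form c (column F j) m
    else if (i == m) && (j == m) then d else F i j); last first.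
  apply/funext => x.
  by rewrite -[LHS]/(backward rho m _ i j) /backward column_completion.
case: ((i < m)%N && (j < m)%N) / andP => [[im jm]|_] /=.
  exact: (continuous_chol_mul q0).
case: ((i == m) && (j < m)%N); last by case: ((i == m) && (j == m)).
apply: (@continuousM R T (fun x => - (rho m * resid_norm (column (A x) m) m))).
  exact: continuousN.
exact: (continuous_prefix_form q0).
Qed.

End Continuity.

(** * The operator norm ball and its projection *)

Section OperatorBall.
Variables (R : realType) (n : nat).
Implicit Types (X : 'M[R]_n) (v : 'cV[R]_n).

Lemma sqr_euclidean_norm v : euclidean_norm v ^+ 2 = \sum_i v i 0 ^+ 2.
Proof. by rewrite sqr_sqrtr // sumr_ge0 // => i _; apply: sqr_ge0. Qed.

Lemma euclidean_norm_ge0 v : 0 <= euclidean_norm v.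
Proof. exact: sqrtr_ge0. Qed.

Lemma euclidean_normZ (a : R) v : euclidean_norm (a *: v) = `|a| * euclidean_norm v.
Proof.
rewrite /euclidean_norm -sqrtr_sqr -sqrtrM ?sqr_ge0 // mulr_sumr.
by congr Num.sqrt; apply: eq_bigr => i _; rewrite mxE exprMn.
Qed.

Lemma euclidean_norm_eq0 v : euclidean_norm v = 0 -> v = 0.
Proof.
move=> h; have := sqr_euclidean_norm v; rewrite h expr0n /= => /esym/eqP.
rewrite psumr_eq0 => [/allP h0|i _]; last exact: sqr_ge0.
apply/colP => i; rewrite mxE; apply/eqP; rewrite -sqrf_eq0.
exact: h0 (mem_index_enum i).
Qed.

(** [sup] dominates the elements of a set only when the set is bounded above. The bound comes from
    absolute row sums, as each coordinate of v is at most 1 in absolute value. *)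
Lemma operator_norm_has_ubound X :
  has_ubound [set euclidean_norm (X *m v) | v in [set v | euclidean_norm v <= 1]].
Proof.
exists (Num.sqrt (\sum_i (\sum_j `|X i j|) ^+ 2)) => _ [v /= v1 <-].
apply: ler_wsqrtr; apply: ler_sum => i _; rewrite mxE -real_normK ?num_real //.
rewrite lerXn2r ?nnegrE //; last first.
  apply: le_trans (ler_norm_sum _ _ _) _; apply: ler_sum => j _.
  rewrite normrM ler_piMr //.
  rewrite -(expr_le1 (n := 2)) // real_normK ?num_real //.
  apply: le_trans (_ : euclidean_norm v ^+ 2 <= 1); last first.
    by rewrite expr_le1 ?euclidean_norm_ge0.
  rewrite sqr_euclidean_norm (bigD1 j) //= lerDl sumr_ge0 // => k _; exact: sqr_ge0.
by rewrite sumr_ge0.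
Qed.

Lemma operator_ball_norm X v : operator_ball X ->
  euclidean_norm (X *m v) <= euclidean_norm v.
Proof.
move=> hX; have [v0|v0] := eqVneq (euclidean_norm v) 0.
  rewrite v0 (euclidean_norm_eq0 v0) mulmx0 /euclidean_norm big1 ?sqrtr0 // => i _.
  by rewrite mxE expr0n.
have vp : 0 < euclidean_norm v by rewrite lt0r v0 euclidean_norm_ge0.
have h : euclidean_norm (X *m ((euclidean_norm v)^-1 *: v)) <= 1.
  apply: le_trans hX; apply: ub_le_sup; first exact: operator_norm_has_ubound.
  exists ((euclidean_norm v)^-1 *: v) => //=.
  by rewrite euclidean_normZ gtr0_norm ?invr_gt0 // mulVf.
move: h; rewrite -scalemxAr euclidean_normZ gtr0_norm ?invr_gt0 //.
by rewrite mulrC ler_pdivrMr // mul1r.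
Qed.

End OperatorBall.

(** * Matrices of fixed size as functions on naturals, and interior data *)

Section Fiber.
Variables (R : realType) (n : nat).
Implicit Types (X : 'M[R]_n) (s : 'rV[R]_#|strict_upper n|).

Definition upper_data s : nat -> nat -> R := load (upper_matrix s).

Lemma load_ord m (A : 'M[R]_(m, n)) (i : 'I_m) (j : 'I_n) : load A i j = A i j.
Proof. by rewrite /load !valK. Qed.

Lemma load_mx_of (Y : nat -> nat -> R) i j : (i < n)%N -> (j < n)%N ->
  load (mx_of n Y) i j = Y i j.
Proof. by move=> ni nj; rewrite -[i]/(val (Ordinal ni)) -[j]/(val (Ordinal nj)) load_ord mxE. Qed.

Lemma upper_projP X s : upper_proj X = s <-> agree n (load X) (upper_data s).
Proof.
split=> [<- i j ij jn|h].
  have ni := ltn_trans ij jn.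
  rewrite /upper_data -[i]/(val (Ordinal ni)) -[j]/(val (Ordinal jn)) !load_ord mxE.
  case: insubP => [k _ E|]; last by rewrite /= ij.
  by rewrite mxE enum_rankK E.
rewrite -[RHS]upper_matrixK; apply/rowP => k; rewrite !mxE.
have := h _ _ (valP (enum_val k)) (ltn_ord _); rewrite /upper_data !load_ord => ->.
by rewrite mxE.
Qed.

Lemma orthogonal_groupP X : orthogonal_group X <-> orthonormal_columns n (load X).
Proof.
have E (j k : 'I_n) : \sum_(i < n) load X i j * load X i k = (X^T *m X) j k.
  by rewrite mxE; apply: eq_bigr => i _; rewrite mxE !load_ord.
split=> [h j k jn kn|h].
  by rewrite (E (Ordinal jn) (Ordinal kn)) h mxE.
by apply/matrixP => j k; rewrite -E h // mxE.
Qed.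

Lemma Vset_mx_of (Y : nat -> nat -> R) s : orthonormal_columns n Y -> agree n Y (upper_data s) ->
  Vset s (mx_of n Y).
Proof.
move=> oY aY; split.
  apply/orthogonal_groupP => j k jn kn; rewrite -oY //.
  by apply: eq_bigr => i _; rewrite !load_mx_of.
by apply/upper_projP => i j ij jn; rewrite load_mx_of ?aY // (ltn_trans ij).
Qed.

(** An interior point can be scaled by some 1 + d > 1 inside the projection. Dividing a preimage in
    the ball by 1 + d gives a strict contraction with the original data. *)
Lemma int_contractible s : int_proj_ball s -> contractible n (upper_data s).
Proof.
move=> /nbhs_ballP [e /= e0 he].
(* M is positive and exceeds every coordinate of s in absolute value, so d s has coordinates smaller
   than e. *)
pose M := \sum_k `|s 0 k| + 1.
have M0 : 0 < M by rewrite ltr_wpDl // sumr_ge0.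
pose d := e / M; have d0 : 0 < d by rewrite divr_gt0.
have [] := he ((1 + d) *: s).
  split=> // i j; rewrite (ord1 i) /ball /= mxE mulrDl mul1r opprD addNKr normrN.
  rewrite normrM gtr0_norm //.
  rewrite /d mulrAC ltr_pdivrMr // ltr_pM2l // /M (bigD1 j) //= -addrA ltrDl.
  by rewrite ltr_wpDl // sumr_ge0.
move=> X hX /upper_projP pX.
have d1 : 0 < 1 + d by rewrite addr_gt0.
exists (fun i j => load X i j / (1 + d)).
  move=> i j ij jn; rewrite pX //.
  have ni := ltn_trans ij jn.
  rewrite /upper_data -[i]/(val (Ordinal ni)) -[j]/(val (Ordinal jn)) !load_ord !mxE.
  by case: insubP => [k _ _|]; rewrite ?mxE ?mul0r // mulrAC divff ?mul1r // lt0r_neq0.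
move=> v [k kn vk]; pose w : 'cV[R]_n := \col_i v i.
have wE : \sum_(j < n) v j ^+ 2 = euclidean_norm w ^+ 2.
  by rewrite sqr_euclidean_norm; apply: eq_bigr => j _; rewrite mxE.
have w0 : 0 < \sum_(j < n) v j ^+ 2.
  rewrite (bigD1 (Ordinal kn)) //= ltr_pwDl ?sumr_ge0 // => [|i _]; last exact: sqr_ge0.
  by rewrite lt0r sqrf_eq0 vk sqr_ge0.
have -> : \sum_(i < n) (\sum_(j < n) load X i j / (1 + d) * v j) ^+ 2 =
    euclidean_norm (X *m w) ^+ 2 / (1 + d) ^+ 2.
  rewrite sqr_euclidean_norm mulr_suml; apply: eq_bigr => i _.
  rewrite -expr_div_n; congr (_ ^+ 2); rewrite mxE mulr_suml; apply: eq_bigr => j _.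
  by rewrite mxE load_ord mulrAC.
rewrite ltr_pdivrMr ?exprn_gt0 //.
apply: (@le_lt_trans _ _ (\sum_(j < n) v j ^+ 2)).
  by rewrite wE lerXn2r ?nnegrE ?euclidean_norm_ge0 ?operator_ball_norm.
by rewrite ltr_pMr // exprn_egt1 // ltrDl.
Qed.

End Fiber.

(** * Convexity *)

Section Convexity.
Variable R : realType.
Implicit Types (A X Z : nat -> nat -> R) (rho v : nat -> R) (t : R).

Definition mix t A Z : nat -> nat -> R := fun i j => t * A i j + (1 - t) * Z i j.

Lemma mix_norm n t A Z v : 0 <= t <= 1 ->
  \sum_(i < n) (\sum_(j < n) mix t A Z i j * v j) ^+ 2 <=
  t * \sum_(i < n) (\sum_(j < n) A i j * v j) ^+ 2 +
  (1 - t) * \sum_(i < n) (\sum_(j < n) Z i j * v j) ^+ 2.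
Proof.
move=> /andP [t0 t1]; rewrite !mulr_sumr -big_split; apply: ler_sum => i _ /=.
have -> : \sum_(j < n) mix t A Z i j * v j =
    t * (\sum_(j < n) A i j * v j) + (1 - t) * (\sum_(j < n) Z i j * v j).
  by rewrite !mulr_sumr -big_split; apply: eq_bigr => j _; rewrite /mix /=; ring.
move: (\sum_(j < n) _) (\sum_(j < n) _) => a b.
rewrite -subr_ge0 (_ : _ - _ = t * (1 - t) * (a - b) ^+ 2); last by ring.
by apply: mulr_ge0; [rewrite mulr_ge0 ?subr_ge0 | exact: sqr_ge0].
Qed.

Lemma mix_contractive n t A Z : 0 <= t <= 1 ->
  contractive n A -> contractive n Z -> contractive n (mix t A Z).
Proof.
move=> t01 hA hZ v; apply: le_trans (mix_norm _ _ _ _ t01) _.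
have [t0 t1] := andP t01.
have h1 := ler_wpM2l t0 (hA v).
have h2 : (1 - t) * \sum_(i < n) (\sum_(j < n) Z i j * v j) ^+ 2 <=
    (1 - t) * \sum_(j < n) v j ^+ 2 by rewrite ler_wpM2l ?subr_ge0.
by apply: le_trans (lerD h1 h2) _; rewrite -mulrDl addrC subrK mul1r.
Qed.

Lemma mix_strict_contractive n t A Z : 0 <= t <= 1 ->
  strict_contractive n A -> strict_contractive n Z -> strict_contractive n (mix t A Z).
Proof.
move=> t01 hA hZ v v0; apply: le_lt_trans (mix_norm _ _ _ _ t01) _.
have := hA v v0; have := hZ v v0.
set a := (X in _ < X); set b := \sum_(i < n) _; set c := \sum_(i < n) _ => hb hc.
(* Multiplication by t keeps the first inequality strict only for t > 0; at t = 0 the second one is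
   used. *)
have [t0 t1] := andP t01; have [t_0|tn0] := eqVneq t 0.
  by rewrite t_0 mul0r add0r subr0 mul1r.
have h1 : t * c < t * a by rewrite ltr_pM2l // lt0r tn0.
have h2 : (1 - t) * b <= (1 - t) * a by rewrite ler_wpM2l ?subr_ge0 // ltW.
by apply: lt_le_trans (ltr_leD h1 h2) _; rewrite -mulrDl addrC subrK mul1r.
Qed.

Lemma mix_agree n t A A' Z Z' : agree n A A' -> agree n Z Z' ->
  agree n (mix t A Z) (mix t A' Z').
Proof. by move=> hA hZ i j ij jn; rewrite /mix hA // hZ. Qed.

Lemma mix_contractible n t A Z : 0 <= t <= 1 ->
  contractible n A -> contractible n Z -> contractible n (mix t A Z).
Proof.
move=> t01 [A' aA kA] [Z' aZ kZ]; exists (mix t A' Z'); first exact: mix_agree.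
exact: mix_strict_contractive.
Qed.

Lemma orthonormal_contractive n X : orthonormal_columns n X -> contractive n X.
Proof.
move=> oX v; rewrite le_eqVlt; apply/orP; left; apply/eqP.
under eq_bigr => i _.
  rewrite expr2 big_distrl /=.
  under eq_bigr => j _ do rewrite big_distrr /=.
  over.
rewrite exchange_big /=; apply: eq_bigr => j _; rewrite exchange_big /=.
rewrite (eq_bigr (fun k : 'I_n => v k * v j * (nat_of_ord k == j)%:R)); last first.
  move=> k _; rewrite eq_sym -oX // mulr_sumr; apply: eq_bigr => i _; ring.
by rewrite (sum_delta (fun k => v k * v j)) // expr2.
Qed.

(** A mixture of two orthogonal completions is a contraction with the mixed data, so its diagonal
    lies between the extreme completions of these data. *)
Lemma completion_mix n t A Z i : 0 <= t <= 1 -> contractible n A -> contractible n Z ->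
  (i < n)%N ->
  completion (fun=> -1) n (mix t A Z) i i <=
    t * completion (fun=> -1) n A i i + (1 - t) * completion (fun=> -1) n Z i i /\
  t * completion (fun=> 1) n A i i + (1 - t) * completion (fun=> 1) n Z i i <=
    completion (fun=> 1) n (mix t A Z) i i.
Proof.
move=> t01 gA gZ ni; have gM := mix_contractible t01 gA gZ.
have K rho : (forall k, rho k ^+ 2 = 1) ->
    contractive n (mix t (completion rho n A) (completion rho n Z)).
  move=> h; apply: mix_contractive => //;
    exact: orthonormal_contractive (completion_orthonormal (fun k _ => h k) _).
have G rho : agree n (mix t (completion rho n A) (completion rho n Z)) (mix t A Z).
  by apply: mix_agree; apply: completion_agree.
have s1 (k : nat) : (-1 : R) ^+ 2 = 1 by rewrite sqrrN expr1n.
have s2 (k : nat) : (1 : R) ^+ 2 = 1 by rewrite expr1n.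
by split; [case/andP: (completion_bounds gM (K _ s1) (G _) ni)
          | case/andP: (completion_bounds gM (K _ s2) (G _) ni)].
Qed.

End Convexity.

(** * The algorithm *)

(* Register 0 holds n, register 4 the size m of the current step; registers 1, 2
   and 3 are loop counters.  Array 2 is transformed in place; rows 0 and 1 of
   array 3 hold the residuals and the prefix forms.  Entry (1, 0) of array 3 is
   never written, so the prefix forms start at 0. *)
Definition r_dim := IReg 0.
Definition r_time := IReg 1.
Definition r_col := IReg 2.
Definition r_row := IReg 3.
Definition r_step := IReg 4.
Definition r_next := IAdd r_row (IConst 1).
Definition c_entry := RGet 2 r_row r_step.
Definition y_entry := RGet 2 r_row r_col.
Definition resid_entry (e : iexp) := RGet 3 (IConst 0) e.
Definition prefix_entry (e : iexp) := RGet 3 (IConst 1) e.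
Definition pivot_exp := RDiv (RSqrt (resid_entry r_next)) (RSqrt (resid_entry r_row)).
Definition weight_exp :=
  RDiv c_entry (RMul (RSqrt (resid_entry r_row)) (RSqrt (resid_entry r_next))).
Definition corner_exp := RMul (RGet 1 (IConst 0) r_step) (RSqrt (resid_entry r_step)).

Definition residual_code :=
  Seq (RSet 3 (IConst 0) (IConst 0) (RConst 1))
      (For 3 r_step (RSet 3 (IConst 0) r_next
        (RSub (resid_entry r_row) (RMul c_entry c_entry)))).

(** Both sweeps share this update: [solve_code] runs it after overwriting the entry, [mul_code]
    before, so it always reads an entry of Y. *)
Definition prefix_code := RSet 3 (IConst 1) r_next
  (RAdd (prefix_entry r_row) (RMul weight_exp y_entry)).

Definition solve_code :=
  For 3 r_col (Seq
    (RSet 2 r_row r_col (RDiv (RAdd y_entry (RMul c_entry (prefix_entry r_row))) pivot_exp))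
    prefix_code).

Definition mul_code :=
  Seq (For 3 r_step (Seq prefix_code
        (RSet 2 r_row r_col (RSub (RMul pivot_exp y_entry) (RMul c_entry (prefix_entry r_row))))))
      (RSet 2 r_step r_col
        (RMul (RSub (RConst 0) corner_exp) (prefix_entry r_step))).

(** The residuals are recomputed in every step, as the other steps overwrite them; this linear work
    is dominated by the quadratic sweep over the columns. *)
Definition forward_code := Seq residual_code (For 2 r_step solve_code).

Definition backward_code :=
  Seq residual_code (Seq (For 2 r_step mul_code) (RSet 2 r_step r_step corner_exp)).

Definition copy_code := For 1 r_dim (For 2 r_dim (RSet 2 r_time r_col (RGet 0 r_time r_col))).

(** Loops only count upwards, so the descending pass obtains m as n - (k + 1); the ascending pass
    uses register 4 itself as its counter. *)
Definition completion_code :=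
  Seq copy_code (Seq
    (For 1 r_dim (Seq (ISet 4 (ISub r_dim (IAdd r_time (IConst 1)))) forward_code))
    (For 4 r_dim backward_code)).

(** * Correctness and running time of the program *)

Section Correctness.
Variable R : realType.
Implicit Types (s : state R) (A : nat -> nat -> R) (c rho : nat -> R).

(** A total-correctness triple with a time bound, for one given initial state. *)
Definition runs (p : cmd) s (t : nat) (Q : state R -> Prop) :=
  Q (exec p s).1 /\ ((exec p s).2 <= t)%N.

Lemma runs_seq p1 p2 s t1 t2 t (Q1 Q : state R -> Prop) :
  runs p1 s t1 Q1 -> (forall s', Q1 s' -> runs p2 s' t2 Q) -> ((t1 + t2).+1 <= t)%N ->
  runs (Seq p1 p2) s t Q.
Proof.
move=> [h1 c1] h2 ht; have [q2 c2] := h2 _ h1; split=> //=.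
by apply: leq_trans ht; rewrite ltnS leq_add.
Qed.

Lemma runs_weaken p s t t' (Q Q' : state R -> Prop) :
  runs p s t Q -> (forall s', Q s' -> Q' s') -> (t <= t')%N -> runs p s t' Q'.
Proof. by move=> [h c] hQ ht; split; [exact: hQ | exact: leq_trans ht]. Qed.

(** The bound charges n iterations instead of v, so that nested bounds are polynomials in n
    alone. *)
Lemma runs_for (I : nat -> state R -> Prop) x e p s t n v : (v <= n)%N -> ieval s e = v ->
  I 0 s -> (forall k s', (k < v)%N -> I k s' -> runs p (set_reg s' x k) t (I k.+1)) ->
  runs (For x e p) s ((icost e).+1 + n * t.+1) (I v).
Proof.
move=> vn ev I0 hI; rewrite /runs /= ev.
have : forall k, (k <= v)%N ->
    let r := iteri k (fun k acc => let r := exec p (set_reg acc.1 x k) in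
      (r.1, (acc.2 + r.2).+1)) (s, (icost e).+1) in
    I k r.1 /\ (r.2 <= (icost e).+1 + k * t.+1)%N.
  elim=> [|k IH] kv /=; first by rewrite mul0n addn0.
  have [Ik ck] := IH (ltnW kv); have [Ik' ck'] := hI _ _ kv Ik.
  by split=> //; rewrite mulSn; lia.
move/(_ v (leqnn v)) => /= [Iv cv]; split=> //.
by apply: leq_trans cv _; rewrite leq_add2l leq_mul2r vn orbT.
Qed.

Record ready n rho m A s : Prop := Ready {
  ready_dim : regs s 0 = n;
  ready_step : regs s 4 = m;
  ready_sign : arrays s 1 0 = rho;
  ready_data : arrays s 2 = A;
  ready_prefix : arrays s 3 1 0 = 0
}.

Definition has_residuals m c s := forall i, (i <= m)%N -> arrays s 3 0 i = residual c i.

Lemma residual_code_runs n rho m A s : (m < n)%N -> ready n rho m A s ->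
  runs residual_code s (40 * n) (fun s' => ready n rho m A s' /\ has_residuals m (column A m) s').
Proof.
move=> mn [h0 h4 h1 h2 h3].
(* Here and below, constants are node counts rounded up; the 2 pays for a loop bound held in a
   register. *)
apply: (@runs_seq _ _ _ 10 (2 + n * 20) _
  (fun s' => ready n rho m A s' /\ arrays s' 3 0 0 = 1)); last lia.
  by split=> //=; split=> //; split.
move=> s' [r' q0].
apply: (runs_for (I := fun k s => ready n rho m A s /\ has_residuals k (column A m) s) (v := m)).
- exact: ltnW.
- by case: r'.
- by split=> // i; rewrite leqn0 => /eqP ->; rewrite q0 /residual big_ord0 subr0.
move=> k s1 km [[g0 g4 g1 g2 g3] hq]; split=> //=; split; first by split.
move=> i ik /=; rewrite addn1; case: eqP => [->|ne]; last by apply: hq; lia.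
by rewrite residualS hq // g2 g4 /column expr2.
Qed.

(** The array during an in-place sweep down column j, before row k is treated. *)
Definition replace_column A j (v : nat -> R) k : nat -> nat -> R :=
  fun i' j' => if (j' == j) && (i' < k)%N then v i' else A i' j'.

Lemma set_replace A j v k : (fun i' j' => if (i' == k) && (j' == j) then v k
    else replace_column A j v k i' j') = replace_column A j v k.+1.
Proof.
apply/funext => i'; apply/funext => j'; rewrite /replace_column (ltnS i' k) (leq_eqVlt i' k).
by case: (j' == j); rewrite ?andbF ?andbT //=; case: eqP => [->|].
Qed.

Lemma solve_code_runs n rho m A s j : (j < m)%N -> (m < n)%N -> regs s 2 = j ->
  ready n rho m A s -> has_residuals m (column A m) s ->
  runs solve_code s (70 * n) (fun s' =>
    ready n rho m (replace_column A j (chol_solve (column A m) (column A j)) j) s' /\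
    has_residuals m (column A m) s').
Proof.
move=> jm mn h2 rs hq; set c := column A m; set v := column A j.
pose I k s := [/\ ready n rho m (replace_column A j (chol_solve c v) k) s,
  has_residuals m c s, regs s 2 = j & arrays s 3 1 k = solve_form c v k].
apply: (@runs_weaken _ _ (2 + n * 60) _ (I j)); last 2 first.
- by move=> s' [].
- lia.
apply: (runs_for (I := I) (v := j)).
- exact: ltnW (ltn_trans jm mn).
- by [].
- case: rs => g0 g4 g1 g2 g3; split=> //; split=> //.
  by rewrite g2; apply/funext => i'; apply/funext => j'; rewrite /replace_column ltn0 andbF.
move=> k s' kj [[g0 g4 g1 g2 g3] q' r2 t'].
have km := ltn_trans kj jm.
(* The sweep leaves column m alone since j < m, and entry k of column j still has its original
   value. *)
have Ekm : replace_column A j (chol_solve c v) k k m = c k.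
  by rewrite /replace_column gtn_eqF.
have Ekj : replace_column A j (chol_solve c v) k k j = v k.
  by rewrite /replace_column ltnn andbF.
have q1 := q' _ (ltnW km); have q2 := q' _ km.
split=> //=; rewrite r2 g4 g2 !addn1 /= q1 q2 t' Ekm Ekj.
rewrite !eqxx /= gtn_eqF //.
split=> //; last by rewrite /= eqxx.
by split=> //=; rewrite g2 -set_replace.
Qed.

Lemma forward_code_runs n rho m A s : (m < n)%N -> ready n rho m A s ->
  runs forward_code s (120 * n ^ 2) (fun s' => ready n rho m (forward m A) s').
Proof.
move=> mn rs; apply: (runs_seq (residual_code_runs mn rs) (t2 := 2 + n * (70 * n).+1)); last nia.
move=> {rs}s [rs hq]; set c := column A m in hq.
(* The array once the columns before k have been solved. *)
pose B k : nat -> nat -> R := fun i j =>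
  if (i < j)%N && (j < k)%N then chol_solve c (column A j) i else A i j.
apply: (@runs_weaken _ _ _ _
  (fun s' => ready n rho m (B m) s' /\ has_residuals m c s')); last 2 first.
- by move=> s' [].
- exact: leqnn.
apply: (runs_for (I := fun k s' => ready n rho m (B k) s' /\ has_residuals m c s') (v := m)).
- exact: ltnW.
- by case: rs.
- case: rs => g0 g4 g1 g2 g3; split=> //; split=> //.
  by rewrite g2; apply/funext => i; apply/funext => j; rewrite /B andbF.
move=> k s' km [[g0 g4 g1 g2 g3] q'].
have cB : column (B k) m = c.
  by apply/funext => i; rewrite /column /B (_ : (m < k)%N = false) ?andbF //; lia.
have vB : column (B k) k = column A k.
  by apply/funext => i; rewrite /column /B ltnn andbF.
have := @solve_code_runs n rho m (B k) (set_reg s' 2 k) k km mn.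
rewrite cB vB => H; apply: runs_weaken (H _ _ _) _ (leqnn _) => // s1 [r1 q1].
split=> //; move: r1; congr ready.
apply/funext => i; apply/funext => j; rewrite /replace_column /B ltnS.
case: (ltngtP j k) => [jk|jk|->] /=; rewrite ?andbT ?andbF //; by case: ltnP.
Qed.

Lemma mul_code_runs n rho m A s j : (j < m)%N -> (m < n)%N -> regs s 2 = j ->
  ready n rho m A s -> has_residuals m (column A m) s ->
  runs mul_code s (100 * n) (fun s' =>
    ready n rho m (fun i' j' => if (i' == m) && (j' == j)
      then - (rho m * resid_norm (column A m) m) * prefix_form (column A m) (column A j) m
      else replace_column A j (chol_mul (column A m) (column A j)) m i' j') s' /\
    has_residuals m (column A m) s').
Proof.
move=> jm mn h2 rs hq; set c := column A m; set v := column A j.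
pose I k s := [/\ ready n rho m (replace_column A j (chol_mul c v) k) s,
  has_residuals m c s, regs s 2 = j & arrays s 3 1 k = prefix_form c v k].
apply: (@runs_seq _ _ _ (2 + n * 60) 20 _ (I m)); last lia.
  apply: (runs_for (I := I) (v := m)).
  - exact: ltnW.
  - by case: rs.
  - case: rs => g0 g4 g1 g2 g3; split=> //; last by rewrite /prefix_form big_ord0.
    split=> //.
    by rewrite g2; apply/funext => i'; apply/funext => j'; rewrite /replace_column ltn0 andbF.
  move=> k s' km [[g0 g4 g1 g2 g3] q' r2 t'].
  have Ekm : replace_column A j (chol_mul c v) k k m = c k.
    by rewrite /replace_column gtn_eqF.
  have Ekj : replace_column A j (chol_mul c v) k k j = v k.
    by rewrite /replace_column ltnn andbF.
  have q1 := q' _ (ltnW km); have q2 := q' _ km.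
  split=> //=; rewrite r2 g4 g2 !addn1 /= q1 q2 t' Ekm Ekj.
  rewrite ltn_eqF //.
  split=> //; last by rewrite /= eqxx prefix_formS.
  by split=> //=; rewrite g2 -set_replace.
move=> s' [[g0 g4 g1 g2 g3] q' r2 t']; split=> //=; rewrite g4 r2 g1 q' // t' sub0r.
by split=> //; split=> //=; rewrite g2.
Qed.

Lemma backward_code_runs n rho m A s : (m < n)%N -> ready n rho m A s ->
  runs backward_code s (180 * n ^ 2) (fun s' => ready n rho m (backward rho m A) s').
Proof.
move=> mn rs; apply: (runs_seq (residual_code_runs mn rs)
  (t2 := (2 + n * (100 * n).+1 + 20).+1)); last nia.
move=> {rs}s [rs hq]; set c := column A m in hq.
pose x := rho m * resid_norm c m.
pose B k : nat -> nat -> R := fun i j =>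
  if (j < k)%N && (i < m)%N then chol_mul c (column A j) i
  else if (j < k)%N && (i == m) then - x * prefix_form c (column A j) m else A i j.
apply: (@runs_seq _ _ _ (2 + n * (100 * n).+1) 20 _
  (fun s' => ready n rho m (B m) s' /\ has_residuals m c s')) => //.
  apply: (runs_for (I := fun k s' => ready n rho m (B k) s' /\ has_residuals m c s') (v := m)).
  - exact: ltnW.
  - by case: rs.
  - by case: rs => g0 g4 g1 g2 g3; split=> //; split=> //.
  move=> k s' km [[g0 g4 g1 g2 g3] q'].
  have cB : column (B k) m = c.
    by apply/funext => i; rewrite /column /B (_ : (m < k)%N = false) //; lia.
  have vB : column (B k) k = column A k.
    by apply/funext => i; rewrite /column /B ltnn.
  have := @mul_code_runs n rho m (B k) (set_reg s' 2 k) k km mn.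
  rewrite cB vB => H; apply: runs_weaken (H _ _ _) _ (leqnn _) => // s1 [r1 q1].
  split=> //; move: r1; congr ready.
  apply/funext => i; apply/funext => j; rewrite /replace_column /B ltnS.
  case: (ltngtP j k) => [jk|jk|->] /=; rewrite ?andbF ?andbT //.
  by case: (ltngtP i m).
move=> s' [[g0 g4 g1 g2 g3] q']; split=> //=; rewrite g4 g1 q' //.
split=> //=; rewrite g2; apply/funext => i; apply/funext => j.
rewrite /B /backward -/c -/x.
by case: (ltngtP i m) => im; case: (ltngtP j m) => jm //=; rewrite ?andbF.
Qed.

Lemma iteri_shift (T : Type) (f : nat -> T -> T) k x :
  iteri k.+1 f x = iteri k (fun i => f i.+1) (f 0 x).
Proof. by elim: k => [//|k IH]; rewrite iteriS IH. Qed.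

Lemma completion_iteri rho n A : completion rho n A =
  iteri n (backward rho) (iteri n (fun k => forward (n - k.+1)) A).
Proof.
elim: n A => [//|n IH] A.
rewrite [X in iteri n.+1 _ X]iteri_shift subn1 /=.
by rewrite -[LHS]/(backward rho n (completion rho n (forward n A))) IH.
Qed.

Record loaded n rho A s : Prop := Loaded {
  loaded_dim : regs s 0 = n;
  loaded_sign : arrays s 1 0 = rho;
  loaded_data : arrays s 2 = A;
  loaded_prefix : arrays s 3 1 0 = 0
}.

Lemma ready_loaded n rho m A s : ready n rho m A s -> loaded n rho A s.
Proof. by case. Qed.

(** The program copies only the n by n block; agreement outside it gives equality of the whole
    arrays. *)
Lemma copy_code_runs n rho A s : (0 < n)%N -> loaded n rho A s ->
  (forall i j, ~~ ((i < n) && (j < n))%N -> arrays s 0 i j = A i j) ->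
  runs copy_code s (20 * n ^ 2) (loaded n rho (arrays s 0)).
Proof.
move=> n0 [h0 h1 h2 h3] hout; set B := arrays s 0.
pose J k s' := [/\ regs s' 0 = n, arrays s' 0 = B, arrays s' 1 0 = rho & arrays s' 3 1 0 = 0] /\
  arrays s' 2 = fun i j => if (i < k)%N && (j < n)%N then B i j else A i j.
apply: (@runs_weaken _ _ (2 + n * (2 + n * 8).+1) _ (J n)); last 2 first.
- move=> s' [[g0 gB g1 g3] g2]; split=> //; rewrite g2.
  apply/funext => i; apply/funext => j; case: ifP => // /negbT hij.
  by rewrite -hout.
- nia.
apply: (runs_for (I := J)) => //.
move=> k s' kn [[g0 gB g1 g3] g2].
pose K l s1 := [/\ regs s1 0 = n, regs s1 1 = k, arrays s1 0 = B, arrays s1 1 0 = rho &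
    arrays s1 3 1 0 = 0] /\
  arrays s1 2 = fun i j => if ((i < k) && (j < n) || (i == k) && (j < l))%N then B i j else A i j.
apply: (@runs_weaken _ _ (2 + n * 8) _ (K n)); last 2 first.
- move=> s1 [[e0 e1 eB e2 e3] e4]; split=> //; rewrite e4.
  apply/funext => i; apply/funext => j; rewrite ltnS [(i <= k)%N]leq_eqVlt.
  by case: (i == k); case: (i < k)%N; case: (j < n)%N.
- exact: leqnn.
apply: (runs_for (I := K)) => //.
  split=> //=; rewrite g2; apply/funext => i; apply/funext => j.
  by rewrite andbF orbF.
move=> l s1 ln [[e0 e1 eB e2 e3] e4]; split=> //; split=> //=.
rewrite e1 eB e4; apply/funext => i; apply/funext => j.
have [->|ik] := eqVneq i k; rewrite ?ltnn //= ltnS [(j <= l)%N]leq_eqVlt.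
by have [->|jl] := eqVneq j l.
Qed.

Lemma completion_code_runs n rho A s : (0 < n)%N -> loaded n rho A s ->
  (forall i j, ~~ ((i < n) && (j < n))%N -> arrays s 0 i j = A i j) ->
  runs completion_code s (500 * n ^ 3) (fun s' => arrays s' 2 = completion rho n (arrays s 0)).
Proof.
move=> n0 ls hout; rewrite completion_iteri.
(* One copy and two passes of n quadratic steps; n > 0 lets the cubic term absorb the lower ones. *)
have n3 : (20 * n ^ 2 + (2 + n * (10 + 120 * n ^ 2).+1 + (2 + n * (180 * n ^ 2).+1)).+1 <
    500 * n ^ 3)%N by nia.
apply: runs_seq (copy_code_runs n0 ls hout) _ n3 => {ls hout} s1.
set B := arrays s 0 => l1.
pose J k s' := loaded n rho (iteri k (fun k => forward (n - k.+1)) B) s'.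
apply: (@runs_seq _ _ _ (2 + n * (10 + 120 * n ^ 2).+1) (2 + n * (180 * n ^ 2).+1) _ (J n)) => //.
  apply: (runs_for (I := J)) => //; first by case: l1.
  move=> k s' kn [g0 g1 g2 g3].
  apply: (@runs_seq _ _ _ 6 (120 * n ^ 2) _
    (ready n rho (n - k.+1) (iteri k (fun k => forward (n - k.+1)) B))); last lia.
    by split=> //; split=> //=; rewrite g0 addn1.
  move=> s2 r2; apply: runs_weaken (forward_code_runs _ r2) _ (leqnn _); first lia.
  by move=> s3 /ready_loaded.
move=> s2 l2; set D := iteri n _ B in l2 *.
pose K k s' := loaded n rho (iteri k (backward rho) D) s'.
apply: (@runs_weaken _ _ (2 + n * (180 * n ^ 2).+1) _ (K n)); last 2 first.
- by move=> s' [].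
- exact: leqnn.
apply: (runs_for (I := K)) => //; first by case: l2.
move=> k s' kn [g0 g1 g2 g3].
have r : ready n rho k (iteri k (backward rho) D) (set_reg s' 4 k) by [].
apply: runs_weaken (backward_code_runs kn r) _ (leqnn _).
by move=> s3 /ready_loaded.
Qed.

End Correctness.

(** * The fiber *)

Section Vertices.
Variables (R : realType) (n : nat).
Implicit Types (s : 'rV[R]_#|strict_upper n|) (X : 'M[R]_n) (b : {ffun 'I_n -> bool}).

Definition extreme_diag (e : R) s (i : 'I_n) : R :=
  completion (fun=> e) n (upper_data s) i i.

(** [true] encodes the sign -1, so b marks the positions where the diagonal entry is the lower
    value. *)
Definition signs b (i : nat) : R := if insub i is Some k then (-1) ^+ (b k : bool) else 1.

Definition vertex s b : 'M[R]_n := mx_of n (completion (signs b) n (upper_data s)).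

Lemma signs_ord b (i : 'I_n) : signs b i = (-1) ^+ (b i).
Proof. by rewrite /signs valK. Qed.

Lemma upper_data_mix (t : R) s s' :
  upper_data (t *: s + (1 - t) *: s') = mix t (upper_data s) (upper_data s').
Proof.
apply/funext => i; apply/funext => j; rewrite /mix /upper_data /load.
case: insub => [i'|]; last by rewrite !mulr0 addr0.
case: insub => [j'|]; last by rewrite !mulr0 addr0.
by rewrite !mxE; case: insub => [k|]; rewrite ?mxE ?mulr0 ?addr0.
Qed.

Lemma continuous_upper_data s i j : {for s, continuous (fun s' => upper_data s' i j)}.
Proof.
rewrite /upper_data /load.
case: insub => [i'|]; last exact: cst_continuous.
case: insub => [j'|]; last exact: cst_continuous.
rewrite (_ : (fun s' : 'rV_#|strict_upper n| => _) =
    fun s' => if insub (i', j') is Some k then s' 0 (enum_rank k) else 0); last first.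
  by apply/funext => s'; rewrite mxE.
by case: insub => [k|]; [exact: coord_continuous | exact: cst_continuous].
Qed.

Lemma extreme_diag_continuous e i :
  {within @int_proj_ball R n, continuous (fun s => extreme_diag e s i)}.
Proof.
apply: continuous_in_subspaceT => s; rewrite inE => hs.
apply: continuous_completion; first exact: int_contractible.
by move=> k l; apply: continuous_upper_data.
Qed.

Section Interior.
Variable s : 'rV[R]_#|strict_upper n|.
Hypothesis hs : int_proj_ball s.

Let gs : contractible n (upper_data s) := int_contractible hs.

(** A diagonal entry depends on its own sign only, which justifies the constant sign vector in
    [extreme_diag]. *)
Lemma completion_diag_sign (rho : nat -> R) e (i : 'I_n) : rho i = e ->
  completion rho n (upper_data s) i i = extreme_diag e s i.
Proof.
move=> h; have [g _ E] := completion_diag gs (ltn_ord i).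
by apply/eqP; rewrite -subr_eq0 E h subrr mulr0.
Qed.

Lemma extreme_diag_lt (i : 'I_n) : extreme_diag (-1) s i < extreme_diag 1 s i.
Proof.
have [g g0 E] := completion_diag gs (ltn_ord i).
by rewrite -subr_gt0 E mulr_gt0 // opprK addr_gt0.
Qed.

Lemma Vset_completion (rho : nat -> R) : (forall i, (i < n)%N -> rho i = 1 \/ rho i = -1) ->
  Vset s (mx_of n (completion rho n (upper_data s))).
Proof.
move=> h; apply: Vset_mx_of; last exact: completion_agree.
apply: completion_orthonormal => // i /h [->|->]; by rewrite ?sqrrN expr1n.
Qed.

Lemma vertex_Vset b : Vset s (vertex s b).
Proof.
apply: Vset_completion => i ni.
by rewrite -[i]/(val (Ordinal ni)) signs_ord; case: (b _); auto.
Qed.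

Lemma Vset_vertex X : Vset s X -> exists b, X = vertex s b.
Proof.
move=> [/orthogonal_groupP oX /upper_projP aX].
have [rho hrho E] := completion_surj gs oX aX.
pose b : {ffun 'I_n -> bool} := [ffun i : 'I_n => rho i == -1].
have Eb k : (k < n)%N -> rho k = signs b k.
  move=> kn; rewrite -[k]/(val (Ordinal kn)) signs_ord ffunE /=.
  case: (hrho k kn) => ->; last by rewrite eqxx expr1.
  by rewrite (_ : (1 == -1 :> R) = false) // gt_eqF // ltrN10.
exists b; apply/matrixP => i j.
by rewrite mxE -load_ord E // (eq_completion _ Eb).
Qed.

Lemma vertex_diag b (i : 'I_n) :
  vertex s b i i = extreme_diag (if b i then -1 else 1) s i.
Proof. by rewrite mxE; apply: completion_diag_sign; rewrite signs_ord; case: (b i). Qed.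

Lemma vertex_diag_low b (i : 'I_n) : (vertex s b i i == extreme_diag (-1) s i) = b i.
Proof. by rewrite vertex_diag; case: (b i); rewrite ?eqxx // gt_eqF // extreme_diag_lt. Qed.

Lemma vertex_inj : injective (vertex s).
Proof. by move=> b b' E; apply/ffunP => i; rewrite -!vertex_diag_low E. Qed.

Lemma card_Vset : (Vset s #= `I_(2 ^ n))%card.
Proof.
have -> : Vset s = vertex s @` setT.
  apply/seteqP; split=> [X /Vset_vertex [b ->]|_ [b _ <-]]; first by exists b.
  exact: vertex_Vset.
apply: card_eq_trans; first by apply: inj_card_eq => b b' _ _; apply: vertex_inj.
have -> : [set: {ffun 'I_n -> bool}] =
    (@enum_val {ffun 'I_n -> bool} predT) @` [set: 'I_#|{ffun 'I_n -> bool}|].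
  by apply/seteqP; split=> // b _; exists (enum_rank b) => //; rewrite enum_rankK.
apply: card_eq_trans; first by apply: inj_card_eq => b b' _ _; apply: enum_val_inj.
by rewrite card_ffun card_bool card_ord card_eq_sym card_II.
Qed.

(** The determinant is the product of the signs, and the negative ones sit where the lower value is
    taken. *)
Lemma vertex_special b :
  special_orthogonal_group (vertex s b) <->
  ~~ odd #|[set i : 'I_n | vertex s b i i == extreme_diag (-1) s i]%SET|.
Proof.
have detE : \det (vertex s b) = (-1) ^+ odd #|[set i : 'I_n | b i]%SET|.
  rewrite det_completion // signr_odd -sum1_card [in RHS]big_mkcond /= -prodrXr.
  by apply: eq_bigr => i _; rewrite signs_ord inE; case: (b i).
have -> : [set i : 'I_n | vertex s b i i == extreme_diag (-1) s i]%SET =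
    [set i : 'I_n | b i]%SET by apply/setP => i; rewrite !inE vertex_diag_low.
split=> [[_]|h]; rewrite ?detE; last by split; [case: (vertex_Vset b) | rewrite detE (negbTE h)].
by case: odd => //= /eqP; rewrite expr1 lt_eqF // ltrN10.
Qed.

End Interior.

End Vertices.

Lemma input_state_loaded (R : realType) n (s : 'rV[R]_#|strict_upper n|) (rho : 'rV[R]_n) :
  loaded n (load rho 0) (fun _ _ => 0) (input_state s rho).
Proof. by []. Qed.

Lemma load_out (R : realType) n (A : 'M[R]_n) i j : ~~ ((i < n) && (j < n))%N -> load A i j = 0.
Proof.
rewrite /load; case: insubP => [i' ni _|//]; case: insubP => [j' nj _|//].
by rewrite ni nj.
Qed.

Theorem theorem6 (R : realType) :
  exists alpha beta : forall n : nat, 'rV[R]_#|strict_upper n| -> 'I_n -> R,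
    (forall n : nat,
      [/\ (* 1 *)
          forall s : 'rV[R]_#|strict_upper n|, int_proj_ball s -> (Vset s #= `I_(2 ^ n))%card,
          (* 2 *)
          forall s : 'rV[R]_#|strict_upper n|, int_proj_ball s -> forall i : 'I_n,
            alpha n s i < beta n s i /\
            (forall X, Vset s X -> X i i = alpha n s i \/ X i i = beta n s i),
          (* 3 *)
          forall s : 'rV[R]_#|strict_upper n|, int_proj_ball s ->
            (forall X Y, Vset s X -> Vset s Y ->
               diag_vec X = diag_vec Y -> X = Y) /\
            (forall d : 'rV[R]_n,
               (forall i, d 0 i = alpha n s i \/ d 0 i = beta n s i) ->
               exists! X : 'M[R]_n, Vset s X /\ diag_vec X = d),
          (* 4 *)
          forall i : 'I_n,
            [/\ {within @int_proj_ball R n, continuous (fun s => alpha n s i)},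
                {within @int_proj_ball R n, continuous (fun s => beta n s i)},
                concave_function (@int_proj_ball R n) (fun s => beta n s i) &
                convex_function (@int_proj_ball R n) (fun s => alpha n s i)] &
          (* 5 *)
          forall s : 'rV[R]_#|strict_upper n|, int_proj_ball s -> forall X, Vset s X ->
            (special_orthogonal_group X <->
             ~~ odd #|[set i : 'I_n | X i i == alpha n s i]%SET|)]) /\
    (* 6 *)
    (exists (p : cmd) (C : nat), forall n : nat, (0 < n)%N ->
      forall (s : 'rV[R]_#|strict_upper n|) (rho : 'rV[R]_n),
        int_proj_ball s ->
        (forall i, rho 0 i = -1 \/ rho 0 i = 1) ->
        let result := exec p (input_state s rho) in
        let X := output_matrix n result.1 in
        [/\ (result.2 <= C * n ^ 3)%N,
            Vset s X &
            forall i, (rho 0 i = -1 -> X i i = alpha n s i) /\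
                      (rho 0 i = 1 -> X i i = beta n s i)]).
Proof.
exists (fun n => @extreme_diag R n (-1)), (fun n => @extreme_diag R n 1); split=> [n|].
  split.
  - exact: card_Vset.
  - move=> s hs i; split=> [|X /(Vset_vertex hs) [b ->]]; first exact: extreme_diag_lt.
    by rewrite vertex_diag //; case: (b i); auto.
  - move=> s hs; have uniq_diag X Y : Vset s X -> Vset s Y -> diag_vec X = diag_vec Y -> X = Y.
      move=> /(Vset_vertex hs) [b ->] /(Vset_vertex hs) [b' ->] /rowP E.
      congr vertex; apply/ffunP => i; have := E i; rewrite !mxE -!(vertex_diag_low hs).
      by rewrite !mxE => ->.
    split=> // d hd.
    pose b : {ffun 'I_n -> bool} := [ffun i => d 0 i == extreme_diag (-1) s i].
    have db : diag_vec (vertex s b) = d.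
      apply/rowP => i; rewrite mxE vertex_diag // ffunE.
      case: (hd i) => ->; first by rewrite eqxx.
      by rewrite gt_eqF // extreme_diag_lt.
    exists (vertex s b); split; first by split=> //; exact: vertex_Vset.
    by move=> X [VX dX]; apply: uniq_diag; rewrite ?db //; exact: vertex_Vset.
  - move=> i; split; try exact: extreme_diag_continuous.
    + move=> t s s'; rewrite !inE => hs hs' /=.
      have t01 : 0 <= t%:num <= 1 by rewrite ge0 le1.
      have [_] := completion_mix t01 (int_contractible hs) (int_contractible hs') (ltn_ord i).
      (* Concavity is stated as convexity of the opposite function, so the inequality is negated. *)
      rewrite -upper_data_mix -lerN2 opprD -!mulrN; exact.
    + move=> t s s'; rewrite !inE => hs hs' /=.
      have t01 : 0 <= t%:num <= 1 by rewrite ge0 le1.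
      have [h _] := completion_mix t01 (int_contractible hs) (int_contractible hs') (ltn_ord i).
      by move: h; rewrite -upper_data_mix; exact.
  - by move=> s hs X /(Vset_vertex hs) [b ->]; apply: vertex_special.
exists completion_code, 500%N => n n0 s rho hs hrho.
have [E cost] : runs completion_code (input_state s rho) (500 * n ^ 3) (fun s' =>
    arrays s' 2 = completion (load rho 0) n (upper_data s)).
  by apply: completion_code_runs (input_state_loaded s rho) _ => // i j hij; apply: load_out.
have rhoE (i : 'I_n) : load rho 0 i = rho 0 i by rewrite -[0%N]/(val (0 : 'I_1)) load_ord.
move=> result X; have -> : X = mx_of n (completion (load rho 0) n (upper_data s)).
  by apply/matrixP => i j; rewrite !mxE E.
split=> // [|i].
  apply: Vset_completion => // i ni; rewrite -[i]/(val (Ordinal ni)) rhoE.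
  by case: (hrho (Ordinal ni)) => ->; auto.
by split=> hi; rewrite mxE (completion_diag_sign hs (e := rho 0 i)) // hi.
Qed.
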